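(* Let $K$ be an abstract simplicial complex on vertex set $[m]$. The Halperin–Carlsson conjecture holds for $\mathcal{Z}_K$ (resp. $\mathbb{R}\mathcal{Z}_K$) under the restriction of the natural $T^m$-action (resp. $(\mathbb{Z}_2)^m$-action). That is: if a rank $r$ subtorus $H\cong T^r$ of $T^m$ acts freely on $\mathcal{Z}_K$ by restriction of the natural $T^m$-action, then $\sum_i\dim_{\mathbf{k}_0}H^i(\mathcal{Z}_K;\mathbf{k}_0)\geq 2^r$ for a field $\mathbf{k}_0$ of characteristic $0$; and if a subgroup $H_{\mathbb{R}}\cong(\mathbb{Z}_2)^r$ of $(\mathbb{Z}_2)^m$ acts freely on $\mathbb{R}\mathcal{Z}_K$ by restriction of the natural $(\mathbb{Z}_2)^m$-action, then $\sum_i\dim_{\mathbf{k}_2}H^i(\mathbb{R}\mathcal{Z}_K;\mathbf{k}_2)\geq 2^r$ for a field $\mathbf{k}_2$ of characteristic $2$.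
   Context: $m$ is a positive integer and $[m]=\{1,\dots,m\}$. An abstract simplicial complex $K$ on vertex set $[m]$ is a collection of subsets of $[m]$ closed under taking subsets (including the empty set) whose members have union $[m]$. For a pair of spaces $W\subset X$ put $K(X,W)=\bigcup_{\sigma\in K}\prod_{i=1}^m A_i^\sigma\subset X^m$, where $A_i^\sigma=X$ if $i\in\sigma$ and $A_i^\sigma=W$ if $i\in[m]\setminus\sigma$. The moment-angle complex is $\mathcal{Z}_K=K(D^2,S^1)\subset (D^2)^m\subset\mathbb{C}^m$ ($D^2$ the closed unit disk in $\mathbb{C}$, $S^1=\partial D^2$), and the real moment-angle complex is $\mathbb{R}\mathcal{Z}_K=K(D^1,S^0)\subset(D^1)^m\subset\mathbb{R}^m$ ($D^1=[-1,1]$, $S^0=\{\pm1\}$). The natural action of $T^m=(S^1)^m$ on $\mathcal{Z}_K$ is $(g_1,\dots,g_m)\cdot(z_1,\dots,z_m)=(g_1z_1,\dots,g_mz_m)$, and the natural action of $(\mathbb{Z}_2)^m$, $\mathbb{Z}_2=\{\pm1\}$, on $\mathbb{R}\mathcal{Z}_K$ is given by the same formula. A rank $r$ subtorus of $T^m$ is a closed subgroup isomorphic to $T^r$. The Halperin–Carlsson conjecture states: if a finite-dimensional paracompact Hausdorff space $X$ admits a free action of a torus $T^r$ (resp. a $p$-torus $(\mathbb{Z}_p)^r$, $p$ prime), then $\sum_i\dim_{\mathbf{k}_\ell}H^i(X;\mathbf{k}_\ell)\geq 2^r$, where $\mathbf{k}_\ell$ is a field of characteristic $\ell$ with $\ell=0$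 (resp. $\ell=p$). *)

(* Defs.v *)
From HB Require Import structures.
From mathcomp Require Import all_boot all_order all_algebra.
From mathcomp Require Import complex.
From mathcomp Require Import all_classical all_reals all_analysis.
Import Order.TTheory GRing.Theory Num.Theory.
Import numFieldNormedType.Exports.

Set Implicit Arguments.
Unset Strict Implicit.
Unset Printing Implicit Defensive.

Local Open Scope classical_set_scope.
Local Open Scope ring_scope.

(* R[i] as a numClosedFieldType, so that it carries the topology of the norm. *)
Definition complexes (R : realType) : numClosedFieldType := R[i].

(* The vertex set [m] = {1, ..., m} is 'I_m = {0, ..., m - 1}. *)
Definition simplicial_complex (m : nat) (K : {set {set 'I_m}}) : Prop :=
  [/\ finset.set0 \in K,
      (forall s t : {set 'I_m}, s \in K -> t \subset s -> t \in K) &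
      forall i : 'I_m, exists2 s : {set 'I_m}, s \in K & i \in s].

(* K(X, W), as a subset of the m-th power of the ambient type T; the topology
   on 'rV[T]_m is the product topology. *)
Definition polyhedral_product (T : Type) (m : nat) (K : {set {set 'I_m}})
    (X W : set T) : set 'rV[T]_m :=
  \bigcup_(s in [set` K])
    [set x | forall i : 'I_m, (if i \in s then X else W) (x 0 i)].

(* For F = complexes R these are D^2 and S^1; for F = R they are D^1 = [-1, 1] and
   S^0 = {-1, 1}. *)
Definition unit_disk (F : numFieldType) : set F := [set z | `|z| <= 1].
Arguments unit_disk : clear implicits.
Definition unit_sphere (F : numFieldType) : set F := [set z | `|z| = 1].
Arguments unit_sphere : clear implicits.

Definition moment_angle_complex (R : realType) (m : nat)
    (K : {set {set 'I_m}}) : set 'rV[complexes R]_m :=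
  polyhedral_product K (unit_disk (complexes R)) (unit_sphere (complexes R)).
Arguments moment_angle_complex R {m} K.

Definition real_moment_angle_complex (R : realType) (m : nat)
    (K : {set {set 'I_m}}) : set 'rV[R]_m :=
  polyhedral_product K (unit_disk R) (unit_sphere R).
Arguments real_moment_angle_complex R {m} K.

Section group_actions.
Variable F : numFieldType.

(* T^n for F = complexes R, and (Z_2)^n with Z_2 = {-1, 1} for F = R. *)
Definition sphere_power (n : nat) : set 'rV[F]_n :=
  [set g | forall i, unit_sphere F (g 0 i)].
Arguments sphere_power : clear implicits.

(* Both the group law of sphere_power and its natural action. *)
Definition coord_mul (n : nat) (g z : 'rV[F]_n) : 'rV[F]_n :=
  \row_i (g 0 i * z 0 i).

Definition is_subgroup (m : nat) (H : set 'rV[F]_m) : Prop :=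
  [/\ H `<=` sphere_power m,
      H (const_mx 1),
      (forall g h, H g -> H h -> H (coord_mul g h)) &
      forall g, H g -> H (\row_i (g 0 i)^-1)].

(* phi is a group isomorphism from sphere_power F r onto H, with inverse psi;
   both are total functions, whose values elsewhere are irrelevant. *)
Definition group_isomorphism (r m : nat) (H : set 'rV[F]_m)
    (phi : 'rV[F]_r -> 'rV[F]_m) (psi : 'rV[F]_m -> 'rV[F]_r) : Prop :=
  [/\ (forall t, sphere_power r t -> H (phi t) /\ psi (phi t) = t),
      (forall g, H g -> sphere_power r (psi g) /\ phi (psi g) = g) &
      forall s t, sphere_power r s -> sphere_power r t ->
        phi (coord_mul s t) = coord_mul (phi s) (phi t)].

Definition acts_freely (m : nat) (H X : set 'rV[F]_m) : Prop :=
  forall g x, H g -> X x -> coord_mul g x = x -> g = const_mx 1.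

End group_actions.
Arguments sphere_power : clear implicits.

(* H is isomorphic to T^r as a topological group; T^m is closed in the ambient
   space, so closedness of H may be tested there. *)
Definition is_subtorus (R : realType) (m r : nat) (H : set 'rV[complexes R]_m) :
    Prop :=
  [/\ is_subgroup H, closed H &
      exists (phi : 'rV[complexes R]_r -> 'rV[complexes R]_m)
             (psi : 'rV[complexes R]_m -> 'rV[complexes R]_r),
        [/\ group_isomorphism H phi psi,
            {within sphere_power (complexes R) r, continuous phi} &
            {within H, continuous psi}]].

(* (Z_2)^m is finite and discrete, so no topological condition is needed. *)
Definition is_two_subgroup (R : realType) (m r : nat) (H : set 'rV[R]_m) :
    Prop :=
  is_subgroup H /\
  exists (phi : 'rV[R]_r -> 'rV[R]_m) (psi : 'rV[R]_m -> 'rV[R]_r),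
    group_isomorphism H phi psi.

Section singular_cohomology.
Variable R : realType.

Definition std_simplex (n : nat) : set 'rV[R]_n.+1 :=
  [set x | (forall j, 0 <= x 0 j) /\ \sum_j x 0 j = 1].
Arguments std_simplex : clear implicits.

(* The i-th face inclusion: insert a zero coordinate at position i. *)
Definition face_mx (n : nat) (i : 'I_n.+2) (x : 'rV[R]_n.+1) : 'rV[R]_n.+2 :=
  \row_j (if unlift i j is Some l then x 0 l else 0).

Lemma face_mx_simplex (n : nat) (i : 'I_n.+2) (x : std_simplex n) :
  face_mx i (val x) \in std_simplex n.+1.
Proof.
have [x0 x1] := set_valP x; apply/mem_set; split=> [j|].
  by rewrite mxE; case: unlift => [l|//]; exact: x0.
rewrite (bigD1_ord i) //= mxE unlift_none add0r -x1.
by apply: eq_bigr => j _; rewrite mxE liftK.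
Qed.

Definition face (n : nat) (i : 'I_n.+2) (x : std_simplex n) :
  std_simplex n.+1 := SigSub (face_mx_simplex i x).

Lemma face_mx_continuous (n : nat) (i : 'I_n.+2) : continuous (@face_mx n i).
Proof.
have H (x : 'rV[R]_n.+1) (P : 'I_1 -> 'I_n.+2 -> set R) :
    (forall a b, nbhs (face_mx i x a b) (P a b)) ->
    \forall y \near x, forall a b, P a b (face_mx i y a b).
  move=> Px; have F : Filter (nbhs x) by exact: nbhs_filter.
  apply: (@filter_forall _ _ _ _ F) => a.
  apply: (@filter_forall _ _ _ _ F) => b.
  have := Px a b; rewrite mxE; case E : (unlift i b) => [l|] Pl.
    have : \forall y \near x, P a b ((y : 'rV[R]_n.+1) 0 l).
      by exact: (@coord_continuous R 1 n.+1 0 l x _ Pl).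
    by apply: filterS => y; rewrite mxE E.
  by apply: nearW => y; rewrite mxE E; exact: nbhs_singleton Pl.
by move=> x U [P Px PU]; apply: filterS (H x P Px) => y; exact: PU.
Qed.

Lemma face_continuous (n : nat) (i : 'I_n.+2) : continuous (@face n i).
Proof.
apply: continuous_comp_initial => x.
apply: (@continuous_comp _ _ _ set_val (@face_mx n i)).
  exact: initial_continuous.
exact: face_mx_continuous.
Qed.

HB.instance Definition _ (n : nat) (i : 'I_n.+2) :=
  isContinuous.Build (std_simplex n) (std_simplex n.+1) (@face n i)
    (@face_continuous n i).

Definition singular_simplex (X : topologicalType) (n : nat) : Type :=
  continuousType (std_simplex n) X.

Definition singular_face (X : topologicalType) (n : nat) (i : 'I_n.+2)
  (s : singular_simplex X n.+1) : singular_simplex X n := s \o @face n i.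

Variable k : fieldType.

(* Functions on singular n-simplices, i.e. Hom(C_n(X), k). *)
Definition cochain (X : topologicalType) (n : nat) : lmodType k :=
  (singular_simplex X n -> k^o).

Definition coboundary (X : topologicalType) (n : nat) (c : cochain X n) :
    cochain X n.+1 :=
  fun s => \sum_(i < n.+2) (-1) ^+ i * c (singular_face i s).

Definition cocycles (X : topologicalType) (n : nat) : set (cochain X n) :=
  [set c | coboundary c = 0].

Definition coboundaries (X : topologicalType) (n : nat) : set (cochain X n) :=
  match n with
  | 0 => [set 0]
  | n'.+1 => range (@coboundary X n')
  end.

(* dim_k (Z / B) in [0, +oo], for subspaces B <= Z <= V: the supremum of the
   lengths of the finite families in Z whose classes modulo B are linearly
   independent. *)
Definition quotient_dim (V : lmodType k) (Z B : set V) : \bar R :=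
  ereal_sup [set d | exists n (v : 'I_n -> V),
    [/\ d = n%:R%:E,
        (forall j, Z (v j)) &
        forall a : 'I_n -> k, B (\sum_j a j *: v j) -> forall j, a j = 0]].

Definition cohomology_dim (X : topologicalType) (n : nat) : \bar R :=
  quotient_dim (@cocycles X n) (@coboundaries X n).

Definition total_cohomology_dim (X : topologicalType) : \bar R :=
  (\sum_(0 <= n <oo) cohomology_dim X n)%E.

End singular_cohomology.
Arguments std_simplex : clear implicits.

(* Main.v *)
Require Import Defs.
From HB Require Import structures.
From mathcomp Require Import all_boot all_order all_algebra.
From mathcomp Require Import complex.
From mathcomp Require Import all_classical all_reals all_analysis.
From mathcomp Require Import ring lra zify.
Import Order.TTheory GRing.Theory Num.Theory.
Import numFieldNormedType.Exports.

Set Implicit Arguments.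
Unset Strict Implicit.
Unset Printing Implicit Defensive.

(* Let s be an inclusion-maximal simplex. The point vanishing exactly on s has
   isotropy group T^s, so the 2-torsion of H embeds into that of T^([m] \ s),
   whence r <= m - |s|. It remains to see that the total Betti number is at
   least 2^(m - |s|).

   Let tau be an involution of A changing the sign of a function f and fixing
   A0 = A /\ {f = 0} pointwise. If A0 is a retract of A /\ {|f| < e}, then A has
   at least the total Betti number of A0: a class of A0 that extends to
   A+ = A /\ {f >= 0} pulls back to A along the folding A -> A+, and the other
   classes survive the connecting map H^q(A0) -> H^(q+1)(A), which needs
   excision, proved by barycentric subdivision. Cutting Z_K in this way along
   Re z_i = 0 for all i and along Im z_i = 0 for i in s (R Z_K along x_i = 0 for
   i in s) leaves exactly 2^(m - |s|) points. *)

Local Open Scope classical_set_scope.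
Local Open Scope ring_scope.

(** * Subdivision of tuples *)

(** The cohomology groups are not known to be finite-dimensional, so ranks are only bounded below,
    by families independent modulo coboundaries, and explicit cochains stand in for the exact
    sequences behind the connecting map. All sets being cut lie in one ambient space: a cochain of a
    subset is an ambient cochain regarded up to its values on simplices inside the subset, so
    subspace types appear only at the very end. Classes that survive the connecting map rise by one
    degree while the others keep theirs; hence it is the sum over all degrees that is controlled.
    Cutting along Re turns the disk into a segment and the circle into its two imaginary points; the
    further cut along Im empties the circle part, so such a coordinate must belong to the simplex,
    and maximality of s leaves s alone. Subdivision is developed for tuples in an abstract set,
    where the chain-level identities are inductions on lists; geometry enters only through the
    behaviour of barycenters under affine maps and distances. *)

Section tuple_cochains.
Variables (V : Type) (G : comNzRingType).
Implicit Types (phi psi : seq V -> G) (v w : seq V) (n : nat).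

(* Cochains on tuples of points of any length, the empty tuple included; the
   recursion expresses that prepending a vertex is a contracting homotopy. *)
Fixpoint tuple_coboundary phi v : G :=
  if v is x :: v' then phi v' - tuple_coboundary (phi \o cons x) v' else 0.

Local Notation d := tuple_coboundary.

Lemma tuple_coboundaryB phi psi v :
  d (fun w => phi w - psi w) v = d phi v - d psi v.
Proof.
elim: v phi psi => [|x v IH] phi psi /=; first by rewrite subr0.
by rewrite (IH (phi \o cons x) (psi \o cons x)); ring.
Qed.

(** Faces use only points of [v]. A predicate [P] carries this instead of membership in [v], because
    the recursion shortens [v] while [phi \o cons x] still remembers the removed head. *)
Lemma eq_tuple_coboundary_face n (P : V -> Prop) phi psi v :
    size v = n.+1 -> (forall x, List.In x v -> P x) ->
    (forall w, size w = n -> (forall x, List.In x w -> P x) ->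
       phi w = psi w) ->
  d phi v = d psi v.
Proof.
elim: n P phi psi v => [|n IH] P phi psi [//|x v] /= [sv] vP e.
  by case: v sv {vP} => //= _; rewrite e.
rewrite e //; last by move=> y yv; apply: vP; right.
congr (_ - _); apply: (IH P) => //.
  by move=> y yv; apply: vP; right.
move=> w sw wP; apply: e => /=; first by rewrite sw.
by move=> y [<-|/wP//]; apply: vP; left.
Qed.

Lemma eq_tuple_coboundary n phi psi v :
    size v = n.+1 -> (forall w, size w = n -> phi w = psi w) ->
  d phi v = d psi v.
Proof.
move=> sv e; apply: (eq_tuple_coboundary_face (P := fun=> True) sv) => // w + _.
exact: e.
Qed.

Lemma tuple_coboundary0 phi v : (forall w, phi w = 0) -> d phi v = 0.
Proof.
by elim: v phi => [//|x v IH] phi e /=; rewrite e IH ?subr0// => w /=; rewrite e.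
Qed.

Lemma tuple_coboundaryK phi v : d (d phi) v = 0.
Proof.
elim: v phi => [//|x v IH] phi /=; rewrite tuple_coboundaryB.
by rewrite (IH (phi \o cons x)) subr0 subrr.
Qed.

Lemma tuple_coboundaryE phi v :
  d phi v = \sum_(i < size v) (-1) ^+ i * phi (take i v ++ drop i.+1 v).
Proof.
elim: v phi => [|x v IH] phi /=; first by rewrite big_ord0.
rewrite big_ord_recl /= drop0 expr0 mul1r; congr (_ + _).
by rewrite IH -sumrN; apply: eq_bigr => i _ /=; rewrite exprS mulN1r mulNr.
Qed.

Variable bar : seq V -> V.

(** Dual of Sd v = b * Sd(boundary of v), the cone from the barycenter b of [v] over the subdivided
    boundary. The fuel [n] is meant to be the length of [v], which is one more than the
    dimension. *)
Fixpoint subdivision n phi v : G :=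
  if n is n'.+1 then d (subdivision n' (phi \o cons (bar v))) v else phi v.

(** Dual of T v = b * (v - T(boundary of v)), the usual chain homotopy between the identity and
    Sd. *)
Fixpoint subdivision_homotopy n phi v : G :=
  if n is n'.+1 then
    phi (bar v :: v) - d (subdivision_homotopy n' (phi \o cons (bar v))) v
  else 0.

Local Notation S := subdivision.

Lemma subdivisionS n phi v :
  S n.+1 phi v = d (S n (phi \o cons (bar v))) v.
Proof. by []. Qed.

Lemma subdivision_homotopyS n phi v :
  subdivision_homotopy n.+1 phi v =
    phi (bar v :: v) - d (subdivision_homotopy n (phi \o cons (bar v))) v.
Proof. by []. Qed.

Local Notation T := subdivision_homotopy.

Lemma subdivisionB n phi psi v :
  S n (fun w => phi w - psi w) v = S n phi v - S n psi v.
Proof.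
elim: n phi psi v => [//|n IH] phi psi v /=; rewrite -tuple_coboundaryB.
by congr (d _ v); apply/funext => w; rewrite -IH.
Qed.

Lemma eq_subdivision n phi psi v :
    size v = n -> (forall w, size w = n -> phi w = psi w) ->
  S n phi v = S n psi v.
Proof.
elim: n phi psi v => [|n IH] phi psi v sv e /=; first exact: e.
apply: (eq_tuple_coboundary sv) => w sw; apply: IH => // u su /=.
by apply: e; rewrite /= su.
Qed.

Lemma subdivision0 n phi v : (forall w, phi w = 0) -> S n phi v = 0.
Proof.
elim: n phi v => [|n IH] phi v phi0 /=; first exact: phi0.
by apply: tuple_coboundary0 => w; apply: IH => u; exact: phi0.
Qed.

Lemma eq_subdivision_homotopy n phi psi v :
    size v = n -> (forall w, size w = n.+1 -> phi w = psi w) ->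
  T n phi v = T n psi v.
Proof.
elim: n phi psi v => [//|n IH] phi psi v sv e.
rewrite !subdivision_homotopyS e /= ?sv//; congr (_ - _).
apply: (eq_tuple_coboundary sv) => w sw; apply: IH => // u su /=.
by apply: e; rewrite /= su.
Qed.

Lemma subdivision_homotopy0 n phi v : (forall w, phi w = 0) -> T n phi v = 0.
Proof.
elim: n phi v => [//|n IH] phi v phi0.
rewrite subdivision_homotopyS phi0 tuple_coboundary0 ?subr0// => w.
by apply: IH => u; exact: phi0.
Qed.

Lemma subdivision_homotopyB n phi psi v :
  T n (fun w => phi w - psi w) v = T n phi v - T n psi v.
Proof.
elim: n phi psi v => [|n IH] phi psi v /=; first by rewrite subr0.
rewrite [X in _ - d X _ = _](_ : _ = fun w =>
    T n (phi \o cons (bar v)) w - T n (psi \o cons (bar v)) w).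
  by rewrite tuple_coboundaryB; ring.
by apply/funext => w; rewrite -IH.
Qed.

Lemma subdivision_coboundary n phi v : size v = n.+1 ->
  S n.+1 (d phi) v = d (S n phi) v.
Proof.
elim: n phi v => [|n IH] phi v sv.
  by case: v sv => [|x []] //= _; rewrite subr0.
rewrite subdivisionS.
(* With b = [bar v], [d phi (b :: w) = phi w - d (phi \o cons b) w]; by induction the second term
   subdivides to a coboundary, which the outer [d] kills. *)
transitivity (d (fun w => S n.+1 phi w - d (S n (phi \o cons (bar v))) w) v).
  apply: (eq_tuple_coboundary sv) => w sw.
  by rewrite -IH // -subdivisionB.
by rewrite tuple_coboundaryB tuple_coboundaryK subr0.
Qed.

Lemma subdivision_homotopyP n phi v : size v = n.+1 ->
  d (T n phi) v + T n.+1 (d phi) v = phi v - S n.+1 phi v.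
Proof.
elim: n phi v => [|n IH] phi v sv.
  case: v sv => [|x []] //= _; ring.
rewrite (subdivision_homotopyS n.+1) (subdivisionS n.+1).
set b := bar v; pose phib := phi \o cons b.
(* Again [d phi \o cons b] is [phi - d phib]. Induction trades [T (d phib)] for
   [phib - S phib - d (T phib)], whose last term the outer [d] kills. *)
have -> : d (T n.+1 (d phi \o cons b)) v =
   d (fun w => T n.+1 phi w - (phib w - S n.+1 phib w - d (T n phib) w)) v.
  apply: (eq_tuple_coboundary sv) => w sw.
  have <- : T n.+1 (d phib) w = phib w - S n.+1 phib w - d (T n phib) w.
    by rewrite -(IH phib w sw); ring.
  by rewrite -subdivision_homotopyB.
rewrite !tuple_coboundaryB tuple_coboundaryK -/phib.
have -> : d phi (b :: v) = phi v - d phib v by [].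
ring.
Qed.

End tuple_cochains.

(** * Naturality of tuple subdivision *)

Section tuple_cochain_maps.
Variables (V W : Type) (G : comNzRingType).
Variables (barV : seq V -> V) (barW : seq W -> W).
Variable h : V -> W.
Hypothesis h_bar : forall v, v <> [::] -> barW (map h v) = h (barV v).
Implicit Types (phi : seq W -> G) (v : seq V).

Lemma tuple_coboundary_map phi v :
  tuple_coboundary phi (map h v) = tuple_coboundary (phi \o map h) v.
Proof. by elim: v phi => [//|x v IH] phi /=; rewrite IH. Qed.

Lemma subdivision_map n phi v : size v = n ->
  subdivision barW n phi (map h v) = subdivision barV n (phi \o map h) v.
Proof.
elim: n phi v => [//|n IH] phi v sv.
have v0 : v <> [::] by move=> v0; rewrite v0 in sv.
rewrite !subdivisionS tuple_coboundary_map h_bar//.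
by apply: (eq_tuple_coboundary sv) => w sw /=; rewrite IH.
Qed.

Lemma subdivision_homotopy_map n phi v : size v = n ->
  subdivision_homotopy barW n phi (map h v) =
  subdivision_homotopy barV n (phi \o map h) v.
Proof.
elim: n phi v => [//|n IH] phi v sv.
have v0 : v <> [::] by move=> v0; rewrite v0 in sv.
rewrite !subdivision_homotopyS tuple_coboundary_map h_bar//; congr (_ - _).
by apply: (eq_tuple_coboundary sv) => w sw /=; rewrite IH.
Qed.

End tuple_cochain_maps.

(** * Shrinking of tuples under iterated subdivision *)

Section subdivision_mesh.
Variables (V : Type) (G : comNzRingType) (bar : seq V -> V) (R : realType).
Variable dist : V -> V -> R.
Implicit Types (phi : seq V -> G) (v w : seq V).

Definition spread v (e : R) : Prop :=
  forall x y, List.In x v -> List.In y v -> dist x y <= e.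

Hypothesis dist_sym : forall x y, dist x y = dist y x.
Hypothesis bar_ball : forall c r v, v <> [::] ->
  (forall x, List.In x v -> dist c x <= r) -> dist c (bar v) <= r.
Variables (N : nat) (q : R).
Hypothesis bar_spread : forall v e x, (size v <= N)%N ->
  spread v e -> List.In x v -> dist (bar v) x <= q * e.

(** The clause about balls stands for lying in the convex hull of [v], and it is what makes the
    induction work: applied to the ball of radius [q * e] about [bar v], which contains every face,
    it bounds the distance from the cone vertex to each piece of a subdivided face. *)
Lemma subdivision_mesh n phi v e :
    (n <= N)%N -> size v = n -> spread v e ->
    (forall w, size w = n -> spread w (q * e) ->
       (forall c r, (forall x, List.In x v -> dist c x <= r) ->
          forall y, List.In y w -> dist c y <= r) -> phi w = 0) ->
  subdivision bar n phi v = 0.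
Proof.
elim: n phi v => [|n IH] phi v nN sv ve phi0.
  by case: v sv ve phi0 => // _ _; apply.
have vnil : v <> [::] by case: v sv {ve phi0}.
have bv x : List.In x v -> dist (bar v) x <= q * e.
  by apply: bar_spread => //; rewrite sv.
rewrite subdivisionS -(@tuple_coboundary0 V G (fun=> 0) v)//.
apply: (eq_tuple_coboundary_face (P := fun x => List.In x v) sv) => // w sw wv.
apply: IH => //; first exact: ltnW.
  by move=> x y /wv xv /wv yv; apply: ve.
move=> u su ue uw /=; apply: phi0; first by rewrite /= su.
  have bu y : List.In y u -> dist (bar v) y <= q * e.
    by apply: uw => x /wv; exact: bv.
  move=> x y [<-|xu] [<-|yu].
  - exact: bar_ball.
  - exact: bu.
  - by rewrite dist_sym; exact: bu.
  - exact: ue.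
move=> c r vr y [<-|yu]; first exact: bar_ball.
by apply: uw yu => x /wv; exact: vr.
Qed.

Lemma iter_subdivision_mesh i phi v e :
    (size v <= N)%N -> spread v e ->
    (forall w, size w = size v -> spread w (q ^+ i * e) -> phi w = 0) ->
  iter i (subdivision bar (size v)) phi v = 0.
Proof.
elim: i e v => [|i IH] e v vN ve phi0.
  by apply: phi0 => //; rewrite expr0 mul1r.
rewrite iterS; apply: (@subdivision_mesh _ _ _ e) => // w sw we _.
rewrite -sw; apply: (IH (q * e)); rewrite ?sw// => u su ue.
by apply: phi0 => //; rewrite exprSr -mulrA.
Qed.

End subdivision_mesh.

(** * Affine geometry of the standard simplex *)

Lemma row_continuous (T : topologicalType) (F : topologicalType) n
    (h : T -> 'rV[F]_n) :
  (forall i, continuous (fun x => h x 0 i)) -> continuous h.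
Proof.
move=> hi x U [P Px PU].
have FF : Filter (nbhs x) by exact: nbhs_filter.
apply: (@filterS _ _ _ [set y | forall a b, P a b (h y a b)]).
  by move=> y; exact: PU.
apply: (@filter_forall _ _ _ _ FF) => a; apply: (@filter_forall _ _ _ _ FF) => b.
by have := Px a b; rewrite (ord1 a) => /(hi b x).
Qed.

Lemma sum_continuous (R : realType) (T : topologicalType) n
    (h : 'I_n -> T -> R) :
  (forall i, continuous (h i)) -> continuous (fun x => \sum_i h i x).
Proof.
elim: n h => [|n IH] h hc.
  under [X in continuous X]eq_fun do rewrite big_ord0.
  exact: cst_continuous.
under [X in continuous X]eq_fun do rewrite big_ord_recr.
by move=> x; apply: cvgD; [apply: IH => i; exact: hc|exact: hc].
Qed.

Lemma row_norm_le (R : realType) n (x : 'rV[R]_n) e :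
  0 <= e -> (forall j, `|x 0 j| <= e) -> `|x| <= e.
Proof.
move=> e0 xe; rewrite -[leLHS]/(mx_norm x) mx_normrE.
by apply/bigmax_leP; split => // -[i j] _ /=; rewrite ord1.
Qed.

Section simplex_geometry.
Variable R : realType.
Local Notation Delta n := (std_simplex R n).
Implicit Types n p q : nat.

Lemma simplex_coord_continuous n j :
  continuous (fun x : Delta n => val x 0 j : R).
Proof.
move=> x; apply: (@continuous_comp _ _ _ set_val (fun M : 'rV[R]_n.+1 => M 0 j)).
  exact: initial_continuous.
exact: coord_continuous.
Qed.

Lemma simplex_ge0 n (x : Delta n) j : 0 <= val x 0 j.
Proof. by have [] := set_valP x. Qed.

Lemma simplex_sum1 n (x : Delta n) : \sum_j val x 0 j = 1.
Proof. by have [] := set_valP x. Qed.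

Lemma simplex_inj n (x y : Delta n) :
  (forall j, val x 0 j = val y 0 j) -> x = y.
Proof. by move=> xy; apply/val_inj/rowP. Qed.

Lemma delta_mx_simplex n (i : 'I_n.+1) : delta_mx 0 i \in Delta n.
Proof.
apply/mem_set; split=> [j|]; first by rewrite mxE ler0n.
rewrite (bigD1 i) //= mxE !eqxx big1 ?addr0// => j ji.
by rewrite mxE (negbTE ji) andbF.
Qed.

Definition vertex n (i : 'I_n.+1) : Delta n := SigSub (delta_mx_simplex i).

Definition vertices n : seq (Delta n) := [seq vertex i | i <- enum 'I_n.+1].

Lemma size_vertices n : size (vertices n) = n.+1.
Proof. by rewrite size_map size_enum_ord. Qed.

Lemma nth_vertices n (i : 'I_n.+1) : nth (vertex ord0) (vertices n) i = vertex i.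
Proof.
by rewrite (nth_map i) ?size_enum_ord// nth_ord_enum.
Qed.

Definition affine_mx p q (w : seq (Delta p)) (x : Delta q) : 'rV[R]_p.+1 :=
  \row_l \sum_(j < q.+1) val x 0 j * val (nth (vertex ord0) w j) 0 l.

Lemma affine_mx_simplex p q (w : seq (Delta p)) (x : Delta q) :
  affine_mx w x \in Delta p.
Proof.
apply/mem_set; split=> [l|].
  rewrite mxE; apply: sumr_ge0 => j _; apply: mulr_ge0; exact: simplex_ge0.
under eq_bigr do rewrite mxE.
rewrite exchange_big /= -(simplex_sum1 x); apply: eq_bigr => j _.
by rewrite -mulr_sumr simplex_sum1 mulr1.
Qed.

(* Pitfall: a list [w] shorter than q + 1 is padded with the vertex 0. *)
Definition affine p q (w : seq (Delta p)) (x : Delta q) : Delta p :=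
  SigSub (affine_mx_simplex w x).

Lemma affineE p q (w : seq (Delta p)) (x : Delta q) l :
  val (affine w x) 0 l =
  \sum_(j < q.+1) val x 0 j * val (nth (vertex ord0) w j) 0 l.
Proof. by rewrite mxE. Qed.

Lemma affine_continuous p q (w : seq (Delta p)) : continuous (@affine p q w).
Proof.
apply: continuous_comp_initial; apply: row_continuous => l.
have -> : (fun x : Delta q => (set_val \o affine w) x 0 l) = fun x =>
    \sum_(j < q.+1) val x 0 j * val (nth (vertex ord0) w j) 0 l.
  by apply/funext => x; exact: affineE.
apply: sum_continuous => j x; apply: cvgMr_tmp.
  exact: nbhs_filter.
exact: simplex_coord_continuous.
Qed.

HB.instance Definition _ p q (w : seq (Delta p)) :=
  isContinuous.Build (Delta q) (Delta p) (@affine p q w)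
    (@affine_continuous p q w).

Lemma affine_vertex p q (w : seq (Delta p)) (j : 'I_q.+1) :
  affine w (vertex j) = nth (vertex ord0) w j.
Proof.
apply: simplex_inj => l; rewrite affineE (bigD1 j)//= big1 ?addr0 => [|i ij].
  by rewrite mxE !eqxx mul1r.
by rewrite mxE (negbTE ij) mul0r.
Qed.

Lemma affine_vertices p (x : Delta p) : affine (vertices p) x = x.
Proof.
apply: simplex_inj => l; rewrite affineE (bigD1 l)//= big1 ?addr0 => [|i il].
  by rewrite nth_vertices mxE !eqxx mulr1.
by rewrite nth_vertices mxE eq_sym (negbTE il) mulr0.
Qed.

Lemma map_affine_vertices p q (w : seq (Delta p)) : size w = q.+1 ->
  map (affine w) (vertices q) = w.
Proof.
move=> sw; apply: (@eq_from_nth _ (vertex ord0)).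
  by rewrite size_map size_vertices.
move=> j; rewrite size_map size_vertices => jq.
rewrite (nth_map (vertex ord0)) ?size_vertices//.
by rewrite (nth_vertices (Ordinal jq)) affine_vertex.
Qed.

(** The length bound keeps the padding out of play: [affine w] need not send the default vertex of
    [Delta q] to that of [Delta p]. *)
Lemma affine_comp p q r (w : seq (Delta p)) (u : seq (Delta q)) (x : Delta r) :
  (r < size u)%N -> affine (map (affine w) u) x = affine w (affine u x).
Proof.
move=> ru; apply: simplex_inj => l; rewrite !affineE.
under [RHS]eq_bigr do rewrite affineE mulr_suml.
rewrite exchange_big /=; apply: eq_bigr => j _.
rewrite (nth_map (vertex ord0)); last exact: leq_trans (ltn_ord j) ru.
by rewrite affineE mulr_sumr; apply: eq_bigr => i _; rewrite mulrA.
Qed.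

Lemma affine_face p q (w : seq (Delta p)) (i : 'I_q.+2) (x : Delta q) :
  size w = q.+2 ->
  affine w (face i x) = affine (take i w ++ drop i.+1 w) x.
Proof.
move=> sw; apply: simplex_inj => l; rewrite !affineE (bigD1_ord i)//=.
rewrite mxE unlift_none mul0r add0r; apply: eq_bigr => j _.
rewrite mxE liftK; set u := nth _ w _; suff -> : nth (vertex ord0)
  (take i w ++ drop i.+1 w) j = u by [].
rewrite {}/u /=.
have iq : (i <= size w)%N by rewrite sw ltnW.
rewrite nth_cat size_takel// /bump.
case: ltnP => ji; first by rewrite nth_take.
by rewrite nth_drop; congr nth; lia.
Qed.

Lemma uniform_mx_simplex n : const_mx n.+1%:R^-1 \in Delta n.
Proof.
apply/mem_set; split=> [j|]; first by rewrite mxE invr_ge0.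
under eq_bigr do rewrite mxE.
by rewrite sumr_const card_ord -[LHS]mulr_natr mulVf// pnatr_eq0.
Qed.

(** As an affine image of the uniform point, it commutes with affine maps by [affine_comp]. The
    empty tuple gets the vertex 0, which affine maps may move; hence the nonemptiness conditions. *)
Definition barycenter p (w : seq (Delta p)) : Delta p :=
  affine w (SigSub (uniform_mx_simplex (size w).-1) : Delta (size w).-1).

Lemma barycenter_affine p q (w : seq (Delta p)) (u : seq (Delta q)) :
  u <> [::] -> barycenter (map (affine w) u) = affine w (barycenter u).
Proof.
by case: u => // y u _; rewrite /barycenter -affine_comp// size_map.
Qed.

Definition simplex_dist p (x y : Delta p) : R := `|val x - val y|.

Lemma simplex_dist_sym p (x y : Delta p) : simplex_dist x y = simplex_dist y x.
Proof. exact: distrC. Qed.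

Lemma affine_dist p q (w : seq (Delta p)) (c : Delta p) (x : Delta q) :
  simplex_dist c (affine w x) <=
  \sum_(j < q.+1) val x 0 j * simplex_dist c (nth (vertex ord0) w j).
Proof.
rewrite {1}/simplex_dist.
have -> : val c - val (affine w x) =
    \sum_(j < q.+1) val x 0 j *: (val c - val (nth (vertex ord0) w j)).
  under eq_bigr do rewrite scalerBr.
  rewrite sumrB -scaler_suml simplex_sum1 scale1r; congr (_ - _).
  apply/rowP => l; rewrite summxE mxE; apply: eq_bigr => j _.
  by rewrite !mxE.
apply: (le_trans (ler_norm_sum _ _ _)); apply: ler_sum => j _.
by rewrite normrZ ger0_norm//; exact: simplex_ge0.
Qed.

Lemma barycenter_dist p c (w : seq (Delta p)) : w <> [::] ->
  simplex_dist c (barycenter w) <=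
  (size w)%:R^-1 * \sum_(j < size w) simplex_dist c (nth (vertex ord0) w j).
Proof.
case: w => // x w _; apply: (le_trans (affine_dist _ _ _)).
by rewrite mulr_sumr; apply: ler_sum => j _; rewrite mxE.
Qed.

Lemma In_nth p (w : seq (Delta p)) j : (j < size w)%N ->
  List.In (nth (vertex ord0) w j) w.
Proof. by elim: w j => [//|x w IH] [|j] /=; [left|right; exact: IH]. Qed.

Lemma nth_In p (w : seq (Delta p)) x : List.In x w ->
  exists2 j, (j < size w)%N & nth (vertex ord0) w j = x.
Proof.
elim: w => [//|y w IH] /= [->|/IH[j js <-]]; first by exists 0.
by exists j.+1.
Qed.

Lemma barycenter_ball p c r (w : seq (Delta p)) : w <> [::] ->
  (forall x, List.In x w -> simplex_dist c x <= r) ->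
  simplex_dist c (barycenter w) <= r.
Proof.
move=> w0 wr; apply: (le_trans (barycenter_dist _ w0)).
have s0 : (0 : R) < (size w)%:R by rewrite ltr0n; case: w w0 {wr}.
rewrite ler_pdivrMl//; apply: (@le_trans _ _ (\sum_(j < size w) r)).
  by apply: ler_sum => j _; apply: wr; exact: In_nth.
by rewrite sumr_const card_ord mulr_natl.
Qed.

Lemma barycenter_spread p N (w : seq (Delta p)) e x : (size w <= N)%N ->
  spread (@simplex_dist p) w e -> List.In x w ->
  simplex_dist (barycenter w) x <= (1 - N%:R^-1) * e.
Proof.
move=> wN we xw.
have w0 : w <> [::] by move=> w0; rewrite w0 in xw.
have s0 : (0 < size w)%N by case: w w0 {wN we xw}.
have e0 : 0 <= e by apply: le_trans (we x x xw xw); exact: normr_ge0.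
rewrite simplex_dist_sym; apply: (le_trans (barycenter_dist _ w0)).
have [j js jx] := nth_In xw.
(* The term of [x] itself is zero, so the average of the [size w] distances is at most
   [(1 - (size w)^-1) * e]; this increases with the size, whence the uniform factor with [N]. *)
rewrite (bigD1 (Ordinal js))//= jx /simplex_dist subrr normr0 add0r.
rewrite (@le_trans _ _ ((size w)%:R^-1 * ((size w).-1%:R * e)))//.
  rewrite ler_pM2l ?invr_gt0 ?ltr0n//.
  apply: (@le_trans _ _ (\sum_(i < size w | i != Ordinal js) e)).
    by apply: ler_sum => i _; apply: we => //; exact: In_nth.
  by rewrite sumr_const mulr_natl (cardC1 (Ordinal js)) card_ord.
rewrite mulrA ler_wpM2r// -subn1 natrB// mulrBr mulVf ?pnatr_eq0 -?lt0n//.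
rewrite mulr1 lerD2l lerN2 lef_pV2 ?posrE ?ltr0n ?ler_nat//.
exact: leq_trans s0 wN.
Qed.

Lemma simplex_dist_le1 p (x y : Delta p) : simplex_dist x y <= 1.
Proof.
apply: row_norm_le => // j; rewrite !mxE ler_norml; apply/andP.
have le1 (z : Delta p) : val z 0 j <= 1.
  rewrite -(simplex_sum1 z) (bigD1 j)//= lerDl; apply: sumr_ge0 => l _.
  exact: simplex_ge0.
have := le1 x; have := le1 y.
by have := simplex_ge0 x j; have := simplex_ge0 y j; split; lra.
Qed.

Lemma simplex_compact p : compact (Delta p : set 'rV[R]_p.+1).
Proof.
apply: bounded_closed_compact.
  exists 1; split => // M M1 x xD; apply: le_trans (ltW M1).
  case: xD => x0 x1; apply: row_norm_le => // j.
  rewrite ger0_norm ?x0// -x1 (bigD1 j)//= lerDl.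
  by apply: sumr_ge0 => l _; exact: x0.
have -> : (Delta p : set 'rV[R]_p.+1) =
    \bigcap_(j in [set: 'I_p.+1]) [set x : 'rV[R]_p.+1 | 0 <= x 0 j] `&`
    [set x : 'rV[R]_p.+1 | \sum_j x 0 j = 1].
  apply/seteqP; split=> x /= [x0 x1]; split=> // j; [move=> _; exact: x0|exact: x0].
apply: closedI.
  apply: closed_bigI => j _.
  apply: (@preimage_closed _ _ (fun x : 'rV[R]_p.+1 => x 0 j) [set x | 0 <= x]).
    by move=> x _; exact: coord_continuous.
  exact: closed_ge.
apply: (@preimage_closed _ _ (fun x : 'rV[R]_p.+1 => \sum_j x 0 j) [set x | x = 1]).
  by move=> x _; apply: sum_continuous => j; exact: coord_continuous.
exact: closed_eq.
Qed.

(** The Heine-Cantor theorem, argued on the compact set of ambient row vectors; points of the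
    subtype enter through the equation [val y = x]. *)
Lemma simplex_uniform_continuity p (g : Delta p -> R) (e : R) :
    continuous g -> 0 < e ->
  exists2 d, 0 < d & forall x y, simplex_dist x y <= d -> `|g x - g y| < e.
Proof.
move=> gc e0.
have /compact_near_coveringP/near_covering_withinP cov := @simplex_compact p.
have := cov R (0^'+)%classic (fun d x => forall y z : Delta p, val y = x ->
  simplex_dist y z <= d -> `|g y - g z| < e).
have H x : (Delta p : set 'rV[R]_p.+1) x ->
    \forall x' \near x & d \near 0^'+, Delta p x' -> forall y z : Delta p,
     val y = x' -> simplex_dist y z <= d -> `|g y - g z| < e.
  move=> xD.
  pose x1 : Delta p := SigSub (mem_set xD).
  have : nbhs x1 (g @^-1` ball (g x1) (e / 2)).
    by apply: gc; apply: nbhsx_ballx; rewrite divr_gt0.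
  case=> W [[W' oW' <-] W'x] WB.
  have /nbhs_ballP[r /= r0 rW] : nbhs x W' by apply: open_nbhs_nbhs.
  have r20 : 0 < r / 2 by rewrite divr_gt0.
  exists (ball x (r / 2), [set d | d < r / 2]) => /=.
    split; first exact: nbhsx_ballx.
    exact: nbhs_right_lt.
  move=> [x' d] /= [xx' dr] _ y z yx' yz.
  rewrite -yx' in xx'.
  have Wy : ball x r (val y).
    by apply: le_ball xx'; rewrite ler_pdivrMr// ler_peMr ?ler1n// ltW.
  have Wz : ball x r (val z).
    rewrite (splitr r); apply: (ball_triangle (y := val y)) => //.
  by rewrite mx_norm_ball /ball_ /=; exact: le_lt_trans yz dr.
  have gy : ball (g x1) (e / 2) (g y) by apply: WB; exact: rW.
  have gz : ball (g x1) (e / 2) (g z) by apply: WB; exact: rW.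
  by have := ball_splitr gy gz.
move=> /(_ _ H) [d /= d0 dP].
exists (d / 2); first by rewrite divr_gt0.
move=> x y xy; apply: (dP (d / 2) _ _ (val x)) => //=.
- rewrite sub0r normrN gtr0_norm ?divr_gt0// ltr_pdivrMr// ltr_pMr//.
  by rewrite ltr1n.
- by rewrite divr_gt0.
- exact: set_valP.
Qed.


End simplex_geometry.

(** * Singular subdivision and excision *)

Section singular_subdivision.
Variables (R : realType) (k : fieldType) (X : topologicalType).
Local Notation Delta n := (std_simplex R n).
Local Notation simplex n := (singular_simplex R X n).
Local Notation cochain n := (cochain R k X n).
Local Notation d := (@coboundary R k X _).
Implicit Types (A : set X) (n p : nat).

Lemma eq_simplex n (s t : simplex n) : (forall x, s x = t x) -> s = t.
Proof. by move=> st; apply/continuousEP. Qed.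

Definition affine_restriction n p (s : simplex p) (w : seq (Delta p)) :
    simplex n :=
  s \o affine w.

(** Evaluating on affine simplices inside one standard simplex makes a tuple cochain out of a
    singular one. Identities between tuple cochains then become singular identities at the tuple
    [vertices]. *)
Definition affine_cochain n p (c : cochain n) (s : simplex p) :
    seq (Delta p) -> k :=
  fun w => c (affine_restriction n s w).

Lemma affine_restriction_vertices n (s : simplex n) :
  affine_restriction n s (vertices R n) = s.
Proof. by apply: eq_simplex => x /=; rewrite affine_vertices. Qed.

Lemma affine_cochain_vertices n (c : cochain n) (s : simplex n) :
  affine_cochain c s (vertices R n) = c s.
Proof. by rewrite /affine_cochain affine_restriction_vertices. Qed.

Lemma affine_cochain_coboundary n p (c : cochain n) (s : simplex p) w :
  size w = n.+2 ->
  tuple_coboundary (affine_cochain c s) w = affine_cochain (d c) s w.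
Proof.
move=> sw; rewrite tuple_coboundaryE sw; apply: eq_bigr => i _.
congr (_ * c _); apply: eq_simplex => x /=.
by rewrite affine_face.
Qed.

Lemma affine_cochain_restriction n p q (c : cochain n) (s : simplex p) w u :
  (n < size u)%N ->
  affine_cochain c (affine_restriction q s w) u =
  affine_cochain c s (map (affine w) u).
Proof.
move=> nu; congr c; apply: eq_simplex => x /=.
by rewrite affine_comp.
Qed.

Lemma coboundary_affine n (c : cochain n) (s : simplex n.+1) :
  d c s = tuple_coboundary (affine_cochain c s) (vertices R n.+1).
Proof.
by rewrite affine_cochain_coboundary ?size_vertices// affine_cochain_vertices.
Qed.

Lemma coboundaryK n (c : cochain n) : d (d c) = 0.
Proof.
apply/funext => s; rewrite coboundary_affine.
transitivity (tuple_coboundary (tuple_coboundary (affine_cochain c s))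
   (vertices R n.+2)); last exact: tuple_coboundaryK.
apply: (eq_tuple_coboundary (size_vertices R n.+2)) => w sw.
by rewrite affine_cochain_coboundary.
Qed.

Lemma coboundaryB n (c e : cochain n) : d (c - e) = d c - d e.
Proof.
apply/funext => s; rewrite /coboundary [RHS]/= -[RHS]/(_ - _) -sumrB.
by apply: eq_bigr => i _; rewrite -mulrBr.
Qed.

Lemma coboundaryZ n a (c : cochain n) : d (a *: c) = a *: d c.
Proof.
apply/funext => s; rewrite /coboundary -[RHS]/(_ * _) mulr_sumr.
by apply: eq_bigr => i _; rewrite mulrCA.
Qed.

Lemma coboundary0 n : d (0 : cochain n) = 0.
Proof. by rewrite -(subrr (0 : cochain n)) coboundaryB subrr. Qed.

Lemma coboundaryD n (c e : cochain n) : d (c + e) = d c + d e.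
Proof.
rewrite -{1}[e]opprK coboundaryB -(sub0r e) coboundaryB coboundary0.
by rewrite sub0r opprK.
Qed.

Lemma coboundary_sum n I r (P : pred I) (c : I -> cochain n) :
  d (\sum_(i <- r | P i) c i) = \sum_(i <- r | P i) d (c i).
Proof. exact: (big_morph _ (@coboundaryD n) (coboundary0 n)). Qed.

Definition singular_subdivision n (c : cochain n) : cochain n :=
  fun s =>
    subdivision (@barycenter R n) n.+1 (affine_cochain c s) (vertices R n).

Definition singular_subdivision_homotopy n (c : cochain n.+1) : cochain n :=
  fun s => subdivision_homotopy (@barycenter R n) n.+1 (affine_cochain c s)
             (vertices R n).

Local Notation S := singular_subdivision.
Local Notation T := singular_subdivision_homotopy.

(** [S c] subdivides [Delta n], whereas the right-hand side subdivides the tuple [w] inside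
    [Delta p]; the two agree because [affine w] preserves barycenters. This lets subdivision be
    iterated and combined with faces. *)
Lemma affine_cochain_subdivision n p (c : cochain n) (s : simplex p) w :
  size w = n.+1 ->
  affine_cochain (S c) s w =
    subdivision (@barycenter R p) n.+1 (affine_cochain c s) w.
Proof.
move=> sw; rewrite -[w in RHS](map_affine_vertices sw).
rewrite (subdivision_map (barV := @barycenter R n)) ?size_vertices//; last first.
  by move=> v; exact: barycenter_affine.
apply: eq_subdivision; rewrite ?size_vertices// => u su.
by rewrite affine_cochain_restriction// su.
Qed.

Lemma affine_cochain_subdivision_homotopy n p (c : cochain n.+1)
    (s : simplex p) w :
  size w = n.+1 ->
  affine_cochain (T c) s w =
    subdivision_homotopy (@barycenter R p) n.+1 (affine_cochain c s) w.
Proof.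
move=> sw; rewrite -[w in RHS](map_affine_vertices sw).
rewrite (subdivision_homotopy_map (barV := @barycenter R n)) ?size_vertices//;
  last by move=> v; exact: barycenter_affine.
apply: eq_subdivision_homotopy; rewrite ?size_vertices// => u su.
by rewrite affine_cochain_restriction// su.
Qed.

Lemma coboundary_subdivision n (c : cochain n) : d (S c) = S (d c).
Proof.
apply/funext => s; rewrite coboundary_affine.
transitivity (tuple_coboundary
    (subdivision (@barycenter R n.+1) n.+1 (affine_cochain c s)) (vertices R n.+1)).
  apply: (eq_tuple_coboundary (size_vertices R n.+1)) => w sw.
  by rewrite affine_cochain_subdivision.
rewrite -subdivision_coboundary ?size_vertices//.
apply: eq_subdivision; rewrite ?size_vertices// => w sw.
by rewrite affine_cochain_coboundary.
Qed.

Lemma coboundary_subdivision_homotopy n (c : cochain n.+1) :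
  d (T c) + T (d c) = c - S c.
Proof.
apply/funext => s; rewrite -[LHS]/(_ + _) -[RHS]/(_ - _) coboundary_affine.
rewrite -(affine_cochain_vertices c s).
rewrite -(@subdivision_homotopyP _ _ (@barycenter R n.+1) n.+1) ?size_vertices//.
congr (_ + _).
  apply: (eq_tuple_coboundary (size_vertices R n.+1)) => w sw.
  by rewrite affine_cochain_subdivision_homotopy.
apply: eq_subdivision_homotopy; rewrite ?size_vertices// => w sw.
by rewrite affine_cochain_coboundary.
Qed.

Definition simplex_in n A (s : simplex n) : Prop := forall x, A (s x).

Definition vanishes_on n A (c : cochain n) : Prop :=
  forall s, simplex_in A s -> c s = 0.

Lemma simplex_in_face n A (s : simplex n.+1) i :
  simplex_in A s -> simplex_in A (singular_face i s).
Proof. by move=> sA x; exact: sA. Qed.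

Lemma simplex_inW n A B (s : simplex n) :
  A `<=` B -> simplex_in A s -> simplex_in B s.
Proof. by move=> AB sA x; apply: AB. Qed.

Lemma simplex_in_affine n p A (s : simplex p) w :
  simplex_in A s -> simplex_in A (affine_restriction n s w).
Proof. by move=> sA x; exact: sA. Qed.

Lemma vanishes_onW n A B (c : cochain n) :
  A `<=` B -> vanishes_on B c -> vanishes_on A c.
Proof. by move=> AB cB s sA; apply: cB; exact: simplex_inW sA. Qed.

Lemma vanishes_onB n A (c e : cochain n) :
  vanishes_on A c -> vanishes_on A e -> vanishes_on A (c - e).
Proof. by move=> cA eA s sA; rewrite -[LHS]/(_ - _) cA// eA// subrr. Qed.

Lemma vanishes_onD n A (c e : cochain n) :
  vanishes_on A c -> vanishes_on A e -> vanishes_on A (c + e).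
Proof. by move=> cA eA s sA; rewrite -[LHS]/(_ + _) cA// eA// addr0. Qed.

Lemma vanishes_onZ n A a (c : cochain n) :
  vanishes_on A c -> vanishes_on A (a *: c).
Proof. by move=> cA s sA; rewrite -[LHS]/(_ * _) cA// mulr0. Qed.

Lemma vanishes_on_sum n A I r (P : pred I) (c : I -> cochain n) :
  (forall i, P i -> vanishes_on A (c i)) ->
  vanishes_on A (\sum_(i <- r | P i) c i).
Proof.
by move=> cA; elim/big_ind: _ => //; exact: vanishes_onD.
Qed.

Lemma vanishes_on_coboundary n A (c : cochain n) :
  vanishes_on A c -> vanishes_on A (d c).
Proof.
move=> cA s sA; apply: big1 => i _; rewrite cA ?mulr0//.
exact: simplex_in_face.
Qed.

Lemma vanishes_on_subdivision n A (c : cochain n) :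
  vanishes_on A c -> vanishes_on A (S c).
Proof.
move=> cA s sA; apply: subdivision0 => w; apply: cA.
exact: simplex_in_affine.
Qed.

Lemma vanishes_on_subdivision_homotopy n A (c : cochain n.+1) :
  vanishes_on A c -> vanishes_on A (T c).
Proof.
move=> cA s sA; apply: subdivision_homotopy0 => w; apply: cA.
exact: simplex_in_affine.
Qed.

Lemma affine_cochain_iter_subdivision n i (c : cochain n) (s : simplex n) w :
  size w = n.+1 ->
  affine_cochain (iter i (@S n) c) s w =
  iter i (subdivision (@barycenter R n) n.+1) (affine_cochain c s) w.
Proof.
elim: i w => [//|i IH] w sw; rewrite !iterS affine_cochain_subdivision//.
by apply: eq_subdivision.
Qed.

(** * Excision for a cover by two level sets *)

Section excision.
Variables (f : X -> R) (f_continuous : continuous f) (e : R) (e_gt0 : 0 < e).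

Let U := [set x | - e < f x].
Let V := [set x | f x < e].

Lemma affine_small n (s : simplex n) : exists2 r : R, 0 < r &
  forall (w : seq (Delta n)), size w = n.+1 -> spread (@simplex_dist R n) w r ->
    simplex_in U (affine_restriction n s w) \/
    simplex_in V (affine_restriction n s w).
Proof.
have fs : continuous (f \o s).
  by move=> x; apply: continuous_comp; [exact: cts_fun|exact: f_continuous].
have [r r0 rP] := simplex_uniform_continuity fs e_gt0.
exists r => // w sw wr; pose w0 := nth (vertex R (@ord0 n)) w 0.
have w0w : List.In w0 w by apply: In_nth; rewrite sw.
have dw x : `|f (s w0) - f (s (@affine R n n w x))| < e.
  apply: rP; apply: (le_trans (affine_dist _ _ _)).
  rewrite -[leRHS]mul1r -(simplex_sum1 x) mulr_suml; apply: ler_sum => j _.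
  apply: ler_wpM2l; first exact: simplex_ge0.
  by apply: wr => //; apply: In_nth; rewrite sw.
(* All values of [f] on the small simplex are within [e] of the value at its first vertex, so the
   sign of that value selects [U] or [V]. *)
have [f0|f0] := lerP 0 (f (s w0)); [left|right] => x /=;
  have := dw x; rewrite ltr_norml /U /V /= => /andP[]; lra.
Qed.

Lemma iter_subdivision_vanishes n A (c : cochain n) s :
    simplex_in A s -> vanishes_on (A `&` U) c -> vanishes_on (A `&` V) c ->
  exists i0, forall i, (i0 <= i)%N -> iter i (@S n) c s = 0.
Proof.
move=> sA cU cV; have [r r0 rP] := affine_small s.
(* An n-simplex has [n.+1] vertices, and [Delta n] has diameter at most 1 in the sup norm, so [i]
   subdivisions leave spread at most [q ^+ i]. *)
pose q : R := 1 - n.+1%:R^-1.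
have q0 : 0 <= q by rewrite subr_ge0 invf_le1 ?ler1n ?ltr0n.
have q1 : `|q| < 1 by rewrite ger0_norm// gtrBl invr_gt0 ltr0n.
have [i0 _ i0P] : \forall i \near \oo, q ^+ i < r.
  have := cvg_expr q1 => /cvgrPdist_lt/(_ _ r0).
  by apply: filterS => i; rewrite sub0r normrN ger0_norm// exprn_ge0.
exists i0 => i /i0P /= qi; rewrite -affine_cochain_vertices.
rewrite affine_cochain_iter_subdivision ?size_vertices//.
rewrite -[X in subdivision _ X](size_vertices R n).
apply: (@iter_subdivision_mesh _ _ _ _ (@simplex_dist R n) _ _ n.+1 q _ i _ _ 1).
- exact: simplex_dist_sym.
- by move=> *; exact: barycenter_ball.
- by move=> *; exact: barycenter_spread.
- by rewrite size_vertices.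
- by move=> x y _ _; exact: simplex_dist_le1.
move=> w; rewrite size_vertices mulr1 => sw wq.
case: (rP w sw) => [x y xw yw|wU|wV].
- by apply: le_trans (ltW qi); exact: wq.
- by apply: cU => x; split; [exact: sA|exact: wU].
- by apply: cV => x; split; [exact: sA|exact: wV].
Qed.

(* [b s] is the sum of the [c (T S^i s)]; it is finite because S^i s consists of
   small simplices for large i, and it telescopes under the coboundary. *)
Lemma small_cocycle_coboundary n A (c : cochain n.+1) :
    vanishes_on A (d c) ->
    vanishes_on (A `&` U) c -> vanishes_on (A `&` V) c ->
  exists b : cochain n, [/\ vanishes_on (A `&` U) b, vanishes_on (A `&` V) b &
    vanishes_on A (c - d b)].
Proof.
move=> dc cU cV.
have TU := vanishes_on_subdivision_homotopy cU.
have TV := vanishes_on_subdivision_homotopy cV.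
have vanish_iter i B m (a : cochain m) :
    vanishes_on B a -> vanishes_on B (iter i (@S m) a).
  by elim: i => // i IH /IH /vanishes_on_subdivision.
have d_iter i m (a : cochain m) : d (iter i (@S m) a) = iter i (@S m.+1) (d a).
  by elim: i => // i IH; rewrite !iterS coboundary_subdivision IH.
have iterB i m (a a' : cochain m) :
    iter i (@S m) (a - a') = iter i (@S m) a - iter i (@S m) a'.
  elim: i => [//|i IH]; rewrite !iterS IH; apply/funext => t.
  exact: subdivisionB.
have /choice[K KP] : forall s : simplex n, exists i0, simplex_in A s ->
    forall i, (i0 <= i)%N -> iter i (@S n) (T c) s = 0.
  move=> s; have [sA|nsA] := pselect (simplex_in A s); last by exists 0%N.
  by have [i0 H] := iter_subdivision_vanishes sA TU TV; exists i0.
pose b : cochain n := fun s => \sum_(i < K s) iter i (@S n) (T c) s.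
have bE N s : simplex_in A s -> (K s <= N)%N ->
    b s = \sum_(i < N) iter i (@S n) (T c) s.
  move=> sA KN; rewrite /b -(subnKC KN) big_split_ord /= [X in _ + X]big1 ?addr0//.
  by move=> i _; apply: KP => //=; exact: leq_addr.
exists b; split.
- by move=> s sU; apply: big1 => i _; apply: vanish_iter sU.
- by move=> s sV; apply: big1 => i _; apply: vanish_iter sV.
move=> s sA.
have [i0 i0P] := iter_subdivision_vanishes sA cU cV.
(* Past the bound [K] of every face of [s], one truncation computes [b] on all of them; past [i0],
   the last term of the telescoping sum vanishes at [s]. *)
pose N := maxn i0 (\max_(j < n.+2) K (singular_face j s)).
have dbE :
    d b s = (\sum_(i < N) (iter i (@S n.+1) c - iter i.+1 (@S n.+1) c)) s.
  rewrite /coboundary.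
  transitivity (\sum_(j < n.+2) \sum_(i < N)
      (-1) ^+ j * iter i (@S n) (T c) (singular_face j s)).
    apply: eq_bigr => j _; rewrite (bE N) ?mulr_sumr//; first exact: simplex_in_face.
    apply: leq_trans (leq_maxr _ _).
    exact: (leq_bigmax (F := fun j => K (singular_face j s)) j).
  rewrite exchange_big /= fct_sumE; apply: eq_bigr => i _.
  transitivity (d (iter i (@S n) (T c)) s); first by [].
  rewrite d_iter.
  (* The summand telescopes up to iterated subdivisions of [T (d c)], which vanish on [A] together
     with [d c]. *)
  have -> : d (T c) = (c - S c) - T (d c).
    by rewrite -coboundary_subdivision_homotopy addrK.
  have -> : S (iter i (@S n.+1) c) = iter i (@S n.+1) (S c).
    exact: (iterSr i (@S n.+1) c).
  rewrite (iterB i _ (c - S c)) (iterB i _ c) -[LHS]/(_ - _) -[RHS]/(_ - _).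
  rewrite [X in _ - X = _](_ : _ = 0) ?subr0//.
  by apply: vanish_iter sA; exact: vanishes_on_subdivision_homotopy.
rewrite -[LHS]/(_ - _) dbE.
rewrite -(big_mkord xpredT (fun i => iter i (@S n.+1) c - iter i.+1 (@S n.+1) c)).
under eq_bigr do rewrite -opprB.
rewrite sumrN telescope_sumr//= -[X in _ - X]/(- (_ - _)).
rewrite (i0P N (leq_maxl _ _)) sub0r opprK subrr//.
Qed.

End excision.
End singular_subdivision.

(** * Reflections and total Betti numbers *)

(** Among the matrices whose row space lies in [P], one of maximal rank works: adjoining a vector of
    [P] cannot raise the rank, so that vector was already in the row space. *)
Lemma subspace_mx (k : fieldType) n (P : 'rV[k]_n -> Prop) :
    P 0 -> (forall u v, P u -> P v -> P (u + v)) ->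
    (forall a u, P u -> P (a *: u)) ->
  exists A : 'M[k]_n, forall u, P u <-> (u <= A)%MS.
Proof.
move=> P0 PD PZ.
pose good r :=
  `[< exists2 A : 'M[k]_n, (forall u, (u <= A)%MS -> P u) & \rank A = r >].
have good0 : exists r, good r.
  exists 0; apply/asboolP; exists 0; last exact: mxrank0.
  by move=> u; rewrite submx0 => /eqP->.
have goodn r : good r -> (r <= n)%N.
  by move=> /asboolP[A _ <-]; exact: rank_leq_row.
case: (ex_maxnP good0 goodn) => r /asboolP[A AP Ar] rmax.
exists A => u; split=> [Pu|]; last exact: AP.
have uA : good (\rank (A + u)%MS).
  apply/asboolP; exists (A + u)%MS => // v /sub_addsmxP[[x y] ->].
  apply: PD; first by apply: AP; exact: submxMl.
  by rewrite [y]mx11_scalar mul_scalar_mx; exact: PZ.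
have /eqP AuE : \rank A == \rank (A + u)%MS.
  by rewrite eqn_leq mxrankS ?addsmxSl// Ar rmax.
have : (A + u <= A)%MS by rewrite -(mxrank_leqif_sup (addsmxSl A u)) AuE.
by apply: submx_trans; exact: addsmxSr.
Qed.

(** Rank-nullity without quotient spaces: the rows of [M] are a basis of the coefficient vectors
    whose combination lies in [Q], those of [C] a basis of a complement. *)
Lemma split_family (k : fieldType) (V : lmodType k) N (v : 'I_N -> V)
    (Q : V -> Prop) :
    Q 0 -> (forall x y, Q x -> Q y -> Q (x + y)) ->
    (forall a x, Q x -> Q (a *: x)) ->
  exists a b (M : 'M[k]_(a, N)) (C : 'M[k]_(b, N)),
    [/\ (a + b)%N = N, row_free M, (forall i, Q (\sum_j M i j *: v j)) &
      forall y : 'rV_b, Q (\sum_j (y *m C) 0 j *: v j) -> y = 0].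
Proof.
move=> Q0 QD QZ; pose comb (u : 'rV[k]_N) := \sum_j u 0 j *: v j.
have [||a u|A AP] := @subspace_mx k N (fun u => Q (comb u)).
- by rewrite /comb big1// => j _; rewrite mxE scale0r.
- move=> u w Qu Qw; rewrite /comb; under eq_bigr do rewrite mxE scalerDl.
  by rewrite big_split; exact: QD.
- move=> Qu; rewrite /comb; under eq_bigr do rewrite mxE -scalerA.
  by rewrite -scaler_sumr; exact: QZ.
exists (\rank A), (\rank A^C)%MS, (row_base A), (row_base A^C)%MS; split.
- by rewrite mxrank_compl subnKC// rank_leq_row.
- exact: row_base_free.
- move=> i; have : Q (comb (row i (row_base A))).
    by apply/AP; rewrite (submx_trans (row_sub _ _))// eq_row_base.
  by rewrite /comb; under eq_bigr do rewrite mxE.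
move=> y /AP yA; apply/eqP; rewrite -(mulmx_free_eq0 _ (row_base_free A^C%MS)).
rewrite -submx0 -(capmx_compl A) sub_capmx yA.
by rewrite (submx_trans (submxMl _ _))// eq_row_base.
Qed.

Lemma sum_scalerB (k : fieldType) (V : lmodType k) (I : finType) (a : I -> k)
    (u v : I -> V) :
  \sum_i a i *: (u i - v i) = \sum_i a i *: u i - \sum_i a i *: v i.
Proof. by under eq_bigr do rewrite scalerBr; rewrite sumrB. Qed.

(** * Cohomology of a subset through ambient cochains *)

Section relative_cohomology.
Variables (R : realType) (k : fieldType) (X : topologicalType).
Local Notation simplex n := (singular_simplex R X n).
Local Notation cochain n := (cochain R k X n).
Local Notation d := (@coboundary R k X _).
Implicit Types (A B : set X) (n : nat).

(** Every cochain of the subspace [A] extends by zero to [X], so a primitive on [A] may be sought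
    among the cochains of [X]. *)
Definition coboundary_on A n : cochain n -> Prop :=
  match n with
  | 0 => fun c => vanishes_on A c
  | n'.+1 => fun c => exists b : Defs.cochain R k X n', vanishes_on A (c - d b)
  end.

Lemma vanishes_on_coboundary_on A n (c : cochain n) :
  vanishes_on A c -> coboundary_on A c.
Proof. by case: n c => [//|n] c cA; exists 0; rewrite coboundary0 subr0. Qed.

Lemma coboundary_onD A n (c e : cochain n) :
  coboundary_on A c -> coboundary_on A e -> coboundary_on A (c + e).
Proof.
case: n c e => [|n] c e; first exact: vanishes_onD.
move=> [b bP] [b' bP']; exists (b + b').
by rewrite coboundaryD opprD addrACA; exact: vanishes_onD.
Qed.

Lemma coboundary_onZ A n a (c : cochain n) :
  coboundary_on A c -> coboundary_on A (a *: c).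
Proof.
case: n c => [|n] c; first exact: vanishes_onZ.
move=> [b bP]; exists (a *: b).
by rewrite coboundaryZ -scalerBr; exact: vanishes_onZ.
Qed.

Definition cohomology_rank_ge A n N : Prop :=
  exists v : 'I_N -> cochain n,
    (forall j, vanishes_on A (d (v j))) /\
    forall a : 'I_N -> k,
      coboundary_on A (\sum_j a j *: v j) -> forall j, a j = 0.

Definition pullback (g : continuousType X X) n (c : cochain n) : cochain n :=
  fun s => c (g \o s).

Lemma pullback_coboundary g n (c : cochain n) : d (pullback g c) = pullback g (d c).
Proof.
apply/funext => s; apply: eq_bigr => i _; congr (_ * c _).
exact: eq_simplex.
Qed.

Lemma pullbackB g n (c e : cochain n) :
  pullback g (c - e) = pullback g c - pullback g e.
Proof. by []. Qed.

Lemma pullback_sum g n I r (P : pred I) (a : I -> k) (c : I -> cochain n) :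
  pullback g (\sum_(i <- r | P i) a i *: c i) =
  \sum_(i <- r | P i) a i *: pullback g (c i).
Proof. by apply/funext => s; rewrite /pullback !fct_sumE. Qed.

Lemma vanishes_on_pullback (g : continuousType X X) A B n (c : cochain n) :
  (forall x, A x -> B (g x)) -> vanishes_on B c -> vanishes_on A (pullback g c).
Proof. by move=> gAB cB s sA; apply: cB => x; apply: gAB; exact: sA. Qed.

Lemma pullback_id_on (g : continuousType X X) A n (c : cochain n) :
  (forall x, A x -> g x = x) -> vanishes_on A (pullback g c - c).
Proof.
move=> gA s sA; rewrite -[LHS]/(_ - _) /pullback.
suff -> : (g \o s : simplex n) = s by rewrite subrr.
by apply: eq_simplex => x /=; rewrite gA//; exact: sA.
Qed.

Section reflection.
Variables (A : set X) (f : X -> R) (f_continuous : continuous f).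
Variables (e : R) (e_gt0 : 0 < e) (tau fold retr : continuousType X X).

Let Ap := A `&` [set x | 0 <= f x].
Let An := A `&` [set x | f x <= 0].
Let A0 := A `&` [set x | f x = 0].

Hypothesis tau_half : forall x, Ap x -> An (tau x).
Hypothesis tau_id : forall x, A0 x -> tau x = x.
Hypothesis fold_half : forall x, A x -> Ap (fold x).
Hypothesis fold_tau : forall x, Ap x -> fold (tau x) = x.
Hypothesis retr_zero : forall x, A x -> `|f x| < e -> A0 (retr x).
Hypothesis retr_id : forall x, A0 x -> retr x = x.

Let A0Ap : A0 `<=` Ap.
Proof. by move=> x [Ax /= fx]; split=> //=; rewrite fx. Qed.

Let ApA : Ap `<=` A.
Proof. by move=> x []. Qed.

(* Pull [a] back to {|f| < e} along the retraction, extend it by zero to [b], and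
   let [c1] be its coboundary on {f > -e} and zero on {f < e}: this is a cocycle on
   small simplices, which excision corrects to a cocycle on A. *)
Lemma connecting_cocycle n (a : cochain n) : vanishes_on A0 (d a) ->
  exists (b : cochain n) (c : cochain n.+1),
    [/\ vanishes_on A0 (b - a), vanishes_on A (d c),
        vanishes_on Ap (c - d b) & vanishes_on An c].
Proof.
move=> da.
pose U := [set x | - e < f x]; pose V := [set x | f x < e].
pose W := [set x | `|f x| < e].
pose b : cochain n :=
  fun s => if pselect (simplex_in W s) then pullback retr a s else 0.
pose c1 : cochain n.+1 :=
  fun s => if pselect (simplex_in U s) then d b s else 0.
have dbW : vanishes_on (A `&` W) (d b).
  move=> s sAW; have sW : simplex_in W s by move=> x; case: (sAW x).
  transitivity (d (pullback retr a) s).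
    apply: eq_bigr => i _; rewrite /b; case: pselect => //= nW.
    by exfalso; apply: nW; exact: simplex_in_face.
  rewrite pullback_coboundary.
  by apply: vanishes_on_pullback da _ sAW => x [Ax Wx]; exact: retr_zero.
have c1U s : simplex_in U s -> c1 s = d b s.
  by rewrite /c1; case: pselect.
have c1V : vanishes_on (A `&` V) c1.
  (* A simplex of [A] in both [U] and [V] lies in [W], where [d b] is already zero; hence the two
     prescriptions for [c1] agree. *)
  move=> s sAV; rewrite /c1; case: pselect => //= sU.
  apply: dbW => x; have [Ax Vx] := sAV x; split=> //.
  by rewrite /W /= ltr_norml Vx andbT; exact: sU.
have dc1U : vanishes_on (A `&` U) (d c1).
  move=> s sU; transitivity (d (d b) s); last by rewrite coboundaryK.
  apply: eq_bigr => i _; rewrite c1U// => x.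
  by have [] := sU (face i x).
have dc1V : vanishes_on (A `&` V) (d c1) by exact: vanishes_on_coboundary.
have [c2 [c2U c2V c2P]] : exists c2 : cochain n.+1,
    [/\ vanishes_on (A `&` U) c2, vanishes_on (A `&` V) c2 &
      vanishes_on A (d c1 - d c2)].
  apply: (small_cocycle_coboundary f_continuous e_gt0) => //.
  by rewrite coboundaryK.
exists b, (c1 - c2); split.
- have bW s : simplex_in W s -> b s = pullback retr a s.
    by rewrite /b; case: pselect.
  move=> s sA0; have := pullback_id_on a retr_id sA0.
  rewrite -[X in X = _ -> _]/(_ - _) -[X in _ -> X = _]/(_ - _) bW//.
  by move=> x; have [_ /= fx] := sA0 x; rewrite /W /= fx normr0.
- by rewrite coboundaryB.
- move=> s sAp; rewrite -[LHS]/(c1 s - c2 s - d b s) c1U; last first.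
    by move=> x; have [_ /= fx] := sAp x; apply: lt_le_trans fx; rewrite oppr_lt0.
  rewrite c2U ?subr0 ?subrr// => x; have [Ax /= fx] := sAp x.
  by split=> //; apply: lt_le_trans fx; rewrite oppr_lt0.
- move=> s sAn; have sV : simplex_in (A `&` V) s.
    by move=> x; have [Ax /= fx] := sAn x; split=> //; apply: le_lt_trans fx _.
  by rewrite -[LHS]/(_ - _) c1V// c2V// subrr.
Qed.

Lemma split_rank n N : cohomology_rank_ge A0 n N ->
  exists a b (beta : 'I_a -> cochain n) (alpha : 'I_b -> cochain n),
    [/\ (a + b)%N = N,
        (forall i, vanishes_on Ap (d (beta i))),
        (forall x, coboundary_on A0 (\sum_i x i *: beta i) -> forall i, x i = 0),
        (forall i, vanishes_on A0 (d (alpha i))) &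
        forall y z, vanishes_on Ap (d z) ->
          vanishes_on A0 (\sum_i y i *: alpha i - z) -> forall i, y i = 0].
Proof.
move=> [v [vZ vI]].
(* [Q] describes the image of H^n(A+) in H^n(A0). The [beta] are cocycles on A+ representing the
   part inside this image, the [alpha] are independent modulo it. *)
pose Q (c : cochain n) :=
  exists2 z, vanishes_on Ap (d z) & coboundary_on A0 (c - z).
have coboundary_on0 : coboundary_on A0 (0 : cochain n).
  exact: vanishes_on_coboundary_on.
have [|x y [z zZ zB] [t tZ tB]|x c [z zZ zB]|a [b [M [C [abN Mfree MQ CQ]]]]] :=
  @split_family k (cochain n) N v Q.
- by exists 0; rewrite ?coboundary0 ?subr0.
- exists (z + t); first by rewrite coboundaryD; exact: vanishes_onD.
  by rewrite opprD addrACA; exact: coboundary_onD.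
- exists (x *: z); first by rewrite coboundaryZ; exact: vanishes_onZ.
  by rewrite -scalerBr; exact: coboundary_onZ.
have combE p (D : 'M[k]_(p, N)) (x : 'I_p -> k) :
    \sum_i x i *: (\sum_j D i j *: v j) =
    \sum_j (\row_i x i *m D) 0 j *: v j.
  under eq_bigr do rewrite scaler_sumr.
  rewrite exchange_big /=; apply: eq_bigr => j _.
  rewrite mxE scaler_suml; apply: eq_bigr => i _.
  by rewrite mxE scalerA.
have /choice[beta betaP] : forall i, exists z, vanishes_on Ap (d z) /\
    coboundary_on A0 (\sum_j M i j *: v j - z).
  by move=> i; have [z zZ zB] := MQ i; exists z.
exists a, b, beta, (fun i => \sum_j C i j *: v j); split => //.
- by move=> i; have [] := betaP i.
- move=> x xB i.
  have xM : \row_i x i *m M = 0.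
    apply/rowP => j; rewrite [RHS]mxE.
    apply: (vI (fun j => (\row_i x i *m M) 0 j)); rewrite -combE.
    rewrite -[X in coboundary_on _ X](subrK (\sum_i x i *: beta i)).
    apply: coboundary_onD => //; rewrite -sumrB.
    elim/big_ind: _ => [//||l _]; first exact: coboundary_onD.
    by rewrite -scalerBr; apply: coboundary_onZ; have [] := betaP l.
  have : \row_i x i = 0 by apply/eqP; rewrite -(mulmx_free_eq0 _ Mfree) xM.
  by move=> /rowP/(_ i); rewrite !mxE.
- move=> i; rewrite coboundary_sum; apply: vanishes_on_sum => j _.
  by rewrite coboundaryZ; apply: vanishes_onZ; exact: vZ.
move=> y z zZ yz i.
have : \row_i y i = 0.
  apply: CQ; exists z => //; rewrite -combE; exact: vanishes_on_coboundary_on.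
by move=> /rowP/(_ i); rewrite !mxE.
Qed.

(** Pulling back along [tau] recovers the [beta] on A+, where fold after [tau] is the identity, and
    kills [c], as [tau] maps A+ into A-. A relation on A thus restricts to one on A0. The slot [c]
    will receive the connecting classes. *)
Lemma fold_independent n a (beta : 'I_a -> cochain n) x (c : cochain n) :
    (forall x, coboundary_on A0 (\sum_i x i *: beta i) -> forall i, x i = 0) ->
    vanishes_on An c ->
    coboundary_on A (\sum_i x i *: pullback fold (beta i) + c) ->
  forall i, x i = 0.
Proof.
move=> betaI cn.
have tau_pull : vanishes_on Ap
    (pullback tau (\sum_i x i *: pullback fold (beta i) + c) -
     \sum_i x i *: beta i).
  move=> s sAp; rewrite -pullback_sum -[LHS]/(_ + c (tau \o s) - _).
  rewrite cn ?addr0; last by move=> y; apply: tau_half; exact: sAp.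
  rewrite /pullback.
  suff -> : (fold \o (tau \o s) : simplex n) = s by rewrite subrr.
  by apply: eq_simplex => y /=; rewrite fold_tau//; exact: sAp.
case: n beta c betaI cn tau_pull => [|n] beta c betaI cn tau_pull.
  move=> xc; apply: betaI => s sA0.
  have sAp : simplex_in Ap s by apply: simplex_inW sA0.
  have := tau_pull s sAp; rewrite -[X in X = _ -> _]/(_ - _).
  rewrite /pullback xc ?sub0r => [/eqP|y]; first by rewrite oppr_eq0 => /eqP.
  by have [] := tau_half (sAp y).
move=> [b bP]; apply: betaI; exists (pullback tau b).
apply: (@vanishes_onW _ _ _ _ _ Ap) => //.
rewrite pullback_coboundary.
have := vanishes_on_pullback (g := tau) (A := Ap)
  (fun y Apy => proj1 (tau_half Apy)) bP.
move=> /vanishes_onB/(_ tau_pull); rewrite pullbackB.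
by rewrite opprB addrC subrKA.
Qed.

(** In the Mayer-Vietoris sequence the connecting map kills the images of both halves. Since [tau]
    fixes A0 and maps A+ into A-, whatever extends to A- also extends to A+, so independence modulo
    the image of A+ suffices. *)
Lemma connecting_independent n b (alpha bb : 'I_b -> cochain n)
    (cc : 'I_b -> cochain n.+1) y :
    (forall y z, vanishes_on Ap (d z) ->
      vanishes_on A0 (\sum_i y i *: alpha i - z) -> forall i, y i = 0) ->
    (forall i, vanishes_on A0 (bb i - alpha i)) ->
    (forall i, vanishes_on Ap (cc i - d (bb i))) ->
    (forall i, vanishes_on An (cc i)) ->
    coboundary_on A (\sum_i y i *: cc i) ->
  forall i, y i = 0.
Proof.
move=> alphaI bbA0 ccAp ccAn [g gP].
(* On A+, [d g] equals the combination of the [d (bb i)], and the pullback of [d g] is zero because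
   the [cc i] vanish on A-; so [z] is a cocycle there. On A0 the two terms in [g] cancel, so [z]
   extends the combination of the [alpha i] to A+. *)
pose z := \sum_i y i *: bb i - g + pullback tau g.
apply: (alphaI y z).
  have -> : d z = (\sum_i y i *: cc i - d g) - \sum_i y i *: (cc i - d (bb i)) +
     pullback tau (d g).
    rewrite /z coboundaryD coboundaryB coboundary_sum pullback_coboundary.
    congr (_ + _).
    rewrite (sum_scalerB y cc (fun i => d (bb i))) opprB [RHS]addrC subrKA.
    by congr (_ - _); apply: eq_bigr => i _; rewrite coboundaryZ.
  apply: vanishes_onD.
    apply: vanishes_onB; first exact: vanishes_onW gP.
    by apply: vanishes_on_sum => i _; exact: vanishes_onZ.
  have -> : pullback tau (d g) = pullback tau (\sum_i y i *: cc i) -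
      pullback tau (\sum_i y i *: cc i - d g).
    by rewrite [in RHS]pullbackB opprB addrC subrK.
  apply: vanishes_onB.
    apply: (@vanishes_on_pullback tau Ap An) => //.
    by apply: vanishes_on_sum => i _; exact: vanishes_onZ.
  apply: (@vanishes_on_pullback tau Ap A) => //.
  by move=> x /tau_half[].
have -> : \sum_i y i *: alpha i - z =
    - (\sum_i y i *: (bb i - alpha i)) - (pullback tau g - g).
  rewrite (sum_scalerB y bb alpha) /z opprB !opprD opprK -!addrA.
  by congr (_ + (_ + _)); exact: addrC.
apply: vanishes_onB; last exact: pullback_id_on.
rewrite -scaleN1r; apply: vanishes_onZ.
by apply: vanishes_on_sum => i _; exact: vanishes_onZ.
Qed.

Lemma reflection_rank (N : nat -> nat) :
    (forall n, cohomology_rank_ge A0 n (N n)) ->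
  exists a b : nat -> nat, (forall n, (a n + b n)%N = N n) /\
    forall n, cohomology_rank_ge A n (a n + (if n is n'.+1 then b n' else 0))%N.
Proof.
move=> NP.
have /choice[a] := fun n => split_rank (NP n).
move=> /choice[b]; move=> H; exists a, b; split.
  by move=> n; have [? [? []]] := H n.
move=> n; have [beta [_ [_ betaZ betaI _ _]]] := H n.
have foldZ i : vanishes_on A (d (pullback fold (beta i))).
  by rewrite pullback_coboundary; apply: vanishes_on_pullback (betaZ i).
case: n beta betaZ betaI foldZ => [|n] beta betaZ betaI foldZ.
  rewrite addn0; exists (fun i => pullback fold (beta i)); split=> // x xB.
  apply: (@fold_independent _ _ beta x 0) => //.
  by rewrite addr0.
have [_ [alpha [_ _ _ alphaZ alphaI]]] := H n.
have /choice[bb] := fun i => connecting_cocycle (alphaZ i).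
move=> /choice[cc ccP].
exists (fun j : 'I_(a n.+1 + b n) => match fintype.split j with
  inl i => pullback fold (beta i) | inr i => cc i end); split.
  by move=> j; case: (fintype.split j) => i //; have [] := ccP i.
move=> x; rewrite big_split_ord /=.
under eq_bigr do rewrite (unsplitK (inl _)).
under [X in _ + X]eq_bigr do rewrite (unsplitK (inr _)).
move=> xB.
have xa : forall i, x (lshift (b n) i) = 0.
  apply: (@fold_independent _ _ beta (fun i => x (lshift (b n) i))) xB => //.
  by apply: vanishes_on_sum => i _; apply: vanishes_onZ; have [] := ccP i.
have xb : forall i, x (rshift (a n.+1) i) = 0.
  apply: (@connecting_independent n _ alpha bb cc
    (fun i => x (rshift (a n.+1) i))) => //.
  - by move=> i; have [] := ccP i.
  - by move=> i; have [] := ccP i.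
  - by move=> i; have [] := ccP i.
  move: xB; rewrite big1 ?add0r// => i _.
  by rewrite xa scale0r.
by move=> j; rewrite -(splitK j); case: (fintype.split j) => i /=.
Qed.

End reflection.
End relative_cohomology.

(** * Total ranks and the cohomology of the subspace *)

Section total_rank.
Variables (R : realType) (k : fieldType) (X : topologicalType).
Implicit Types (A : set X) (t : nat).

Definition total_rank_ge A t : Prop :=
  exists (N : nat -> nat) (M : nat),
    (forall n, @cohomology_rank_ge R k X A n (N n)) /\ (t <= \sum_(n < M) N n)%N.

Lemma cohomology_rank_ge0 A n : @cohomology_rank_ge R k X A n 0.
Proof. by exists (fun=> 0); split=> [[]|a _ []]. Qed.

Lemma reflection_total_rank A (f : X -> R) (e : R)
    (tau fold retr : continuousType X X) t :
    continuous f -> 0 < e ->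
    (forall x, A x -> 0 <= f x -> A (tau x) /\ f (tau x) <= 0) ->
    (forall x, A x -> f x = 0 -> tau x = x) ->
    (forall x, A x -> A (fold x) /\ 0 <= f (fold x)) ->
    (forall x, A x -> 0 <= f x -> fold (tau x) = x) ->
    (forall x, A x -> `|f x| < e -> A (retr x) /\ f (retr x) = 0) ->
    (forall x, A x -> f x = 0 -> retr x = x) ->
  total_rank_ge (A `&` [set x | f x = 0]) t -> total_rank_ge A t.
Proof.
move=> fc e0 tauA tau0 foldA foldtau retrA retr0 [N [M [NP tN]]].
have [a [b [abN abP]]] : exists a b : nat -> nat,
    (forall n, (a n + b n)%N = N n) /\
    forall n, @cohomology_rank_ge R k X A n
      (a n + (if n is n'.+1 then b n' else 0))%N.
  apply: (@reflection_rank R k X A f fc e e0 tau fold retr) => //.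
  - by move=> x [Ax fx]; exact: tauA.
  - by move=> x [Ax fx]; exact: tau0.
  - by move=> x [Ax fx]; exact: foldtau.
  - by move=> x [Ax fx]; exact: retr0.
(* One more degree is summed, to catch the connecting classes that come from degree [M - 1]. *)
exists (fun n => a n + (if n is n'.+1 then b n' else 0))%N, M.+1; split=> //.
apply: leq_trans tN _; rewrite big_split /= [X in (_ <= _ + X)%N]big_ord_recl /=.
rewrite add0n big_ord_recr /= -addnA addnCA.
apply: leq_trans (leq_addl _ _); rewrite -big_split /=.
by apply: leq_sum => i _; rewrite abN.
Qed.

Lemma set_val_continuous A : continuous (set_val : A -> X).
Proof. exact: initial_continuous. Qed.

Lemma cohomology_dim_ge A n N : @cohomology_rank_ge R k X A n N ->
  (N%:R%:E <= cohomology_dim R k A n)%E.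
Proof.
move=> [v [vZ vI]].
pose incl p (s : singular_simplex R A p) : singular_simplex R X p :=
  mkcts (@set_val_continuous A) \o s.
have incl_in p (s : singular_simplex R A p) : simplex_in A (incl p s).
  by move=> x; exact: set_valP.
(* A partial inverse of [incl]: [None] is allowed for simplices leaving [A]. Below, it extends a
   primitive on the subspace by zero to the ambient space. *)
have lift_ex p (s : singular_simplex R X p) : exists o, simplex_in A s ->
    exists2 u, o = Some u & incl p u = s.
  have [sA|nsA] := pselect (simplex_in A s); last by exists None.
  pose u0 (x : std_simplex R p) : A := SigSub (mem_set (sA x)).
  have u0c : continuous u0.
    by apply: continuous_comp_initial; exact: cts_fun.
  exists (Some (mkcts u0c : singular_simplex R A p)) => _.
  by exists (mkcts u0c : singular_simplex R A p) => //; exact: eq_simplex.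
pose lift p s := sval (cid (lift_ex p s)).
have lift_incl p s :
    simplex_in A s -> exists2 u, lift p s = Some u & incl p u = s.
  exact: (svalP (cid (lift_ex p s))).
have inclK p : injective (incl p).
  move=> s u su; apply: eq_simplex => x.
  by apply: val_inj; have /continuousEP/(_ x) := su.
apply: ereal_sup_ubound.
exists N, (fun j => (fun s => v j (incl n s)) : cochain R k A n).
split=> //.
  move=> j; apply/funext => s; rewrite -[RHS](vZ j _ (incl_in _ s)).
  apply: eq_bigr => i _; congr (_ * v j _); exact: eq_simplex.
move=> a aB; apply: vI.
have combE (s : singular_simplex R A n) :
    (\sum_j a j *: ((fun s => v j (incl n s)) : cochain R k A n)) s =
    (\sum_j a j *: v j) (incl n s) by rewrite !fct_sumE.
case: n v vZ aB combE => [|n] v vZ aB combE.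
  move=> s /lift_incl[u _ <-].
  by rewrite -combE aB.
case: aB => e _ eE.
exists (fun s => if lift n s is Some u then e u else 0) => s /lift_incl[u _ <-].
rewrite -[LHS]/(_ - _) -combE -eE; apply/eqP; rewrite subr_eq0; apply/eqP.
apply: eq_bigr => i _; congr (_ * _).
have [|w -> wE] := lift_incl n (singular_face i (incl n.+1 u)).
    by apply: simplex_in_face; exact: incl_in.
by congr e; apply: inclK; rewrite wE; exact: eq_simplex.
Qed.

Lemma total_cohomology_dim_ge A t : total_rank_ge A t ->
  (t%:R%:E <= total_cohomology_dim R k A)%E.
Proof.
move=> [N [M [NP tN]]].
apply: (@le_trans _ _ (\sum_(0 <= n < M) cohomology_dim R k A n)%E); last first.
  apply: nneseries_lim_ge => n _ _.
  exact: (cohomology_dim_ge (cohomology_rank_ge0 A n)).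
rewrite big_mkord; apply: (@le_trans _ _ (\sum_(n < M) (N n)%:R%:E)%E).
  by rewrite sumEFin lee_fin -natr_sum ler_nat.
by apply: lee_sum => n _; exact: cohomology_dim_ge.
Qed.

End total_rank.

(** * Cutting one coordinate *)

Section coordinate_cuts.
Variables (R : realType) (k : fieldType) (F : numFieldType) (m : nat).
Variable K : {set {set 'I_m}}.

(** The pair depends on the coordinate, since coordinates are cut one after another and the
    intermediate stages are mixed. *)
Definition pair_product (P : 'I_m -> set F * set F) : set 'rV[F]_m :=
  [set x | exists2 s : {set 'I_m}, s \in K &
    forall i, (if i \in s then (P i).1 else (P i).2) (x 0 i)].

Record folding := Folding {
  height : F -> R;
  mirror : F -> F;
  fold : F -> F;
  retract : F -> F;
  width : R;
  height_continuous : continuous height;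
  mirror_continuous : continuous mirror;
  fold_continuous : continuous fold;
  retract_continuous : continuous retract;
  width_gt0 : 0 < width }.

Record folds (phi : folding) (P : set F) : Prop := Folds {
  mirror_half : forall z, P z -> 0 <= height phi z ->
    P (mirror phi z) /\ height phi (mirror phi z) <= 0;
  mirror_id : forall z, P z -> height phi z = 0 -> mirror phi z = z;
  fold_half : forall z, P z -> P (fold phi z) /\ 0 <= height phi (fold phi z);
  fold_mirror : forall z, P z -> 0 <= height phi z ->
    fold phi (mirror phi z) = z;
  retract_zero : forall z, P z -> `|height phi z| < width phi ->
    P (retract phi z) /\ height phi (retract phi z) = 0;
  retract_id : forall z, P z -> height phi z = 0 -> retract phi z = z }.

(** One folding has to serve both members of the pair: which of them constrains the coordinate
    depends on the simplex, while the reflection must be a single map on the whole product. *)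
Definition cut (Q Q' : set F * set F) : Prop := exists phi : folding,
  [/\ folds phi Q.1, folds phi Q.2,
    Q'.1 = Q.1 `&` [set z | height phi z = 0] &
    Q'.2 = Q.2 `&` [set z | height phi z = 0]].

Definition with_pair (P : 'I_m -> set F * set F) i Q : 'I_m -> set F * set F :=
  fun j => if j == i then Q else P j.

Definition on_coord i (h : F -> F) (x : 'rV[F]_m) : 'rV[F]_m :=
  \row_j (if j == i then h (x 0 j) else x 0 j).

Lemma on_coord_continuous i h : continuous h -> continuous (on_coord i h).
Proof.
move=> hc; apply: row_continuous => j; rewrite /on_coord.
under [X in continuous X]eq_fun do rewrite mxE.
case: (j == i) => x; last exact: coord_continuous.
apply: (@continuous_comp _ _ _ (fun x : 'rV[F]_m => x 0 j) h).
  exact: coord_continuous.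
exact: hc.
Qed.

Lemma cut_total_rank P i Q Q' t : cut Q Q' ->
  total_rank_ge R k (pair_product (with_pair P i Q')) t ->
  total_rank_ge R k (pair_product (with_pair P i Q)) t.
Proof.
move=> [phi [phi1 phi2 Q1 Q2]].
pose f (x : 'rV[F]_m) := height phi (x 0 i).
set A := pair_product (with_pair P i Q).
have fphi (s : {set 'I_m}) : folds phi (if i \in s then Q.1 else Q.2).
  by case: ifP.
have coordP (x : 'rV[F]_m) (s : {set 'I_m}) :
    (forall j,
      (if j \in s then (with_pair P i Q j).1 else (with_pair P i Q j).2) (x 0 j)) ->
    (if i \in s then Q.1 else Q.2) (x 0 i).
  by move=> /(_ i); rewrite /with_pair eqxx.
have onA h (x : 'rV[F]_m) (s : {set 'I_m}) : s \in K ->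
    (forall j,
      (if j \in s then (with_pair P i Q j).1 else (with_pair P i Q j).2) (x 0 j)) ->
    (if i \in s then Q.1 else Q.2) (h (x 0 i)) ->
    A (on_coord i h x).
  move=> sK xs hx; exists s => // j; rewrite mxE; have := xs j; rewrite /with_pair.
  by case: eqP => [->|].
have fon h (x : 'rV[F]_m) : f (on_coord i h x) = height phi (h (x 0 i)).
  by rewrite /f mxE eqxx.
have onid h (x : 'rV[F]_m) : h (x 0 i) = x 0 i -> on_coord i h x = x.
  by move=> hx; apply/rowP => j; rewrite mxE; case: eqP => // ->.
have -> : pair_product (with_pair P i Q') = A `&` [set x | f x = 0].
  apply/seteqP; split=> [x [s sK xs]|x [[s sK xs] fx]].
    split; last first.
      have := xs i; rewrite /with_pair eqxx Q1 Q2.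
      by case: ifP => _ [].
    exists s => // j; have := xs j; rewrite /with_pair; case: eqP => // ->.
    by rewrite Q1 Q2; case: ifP => _ [].
  exists s => // j; have := xs j; rewrite /with_pair; case: eqP => // ->.
  by rewrite Q1 Q2; case: ifP.
apply: (@reflection_total_rank R k _ A f (width phi)
  (mkcts (@on_coord_continuous i _ (@mirror_continuous phi)))
  (mkcts (@on_coord_continuous i _ (@fold_continuous phi)))
  (mkcts (@on_coord_continuous i _ (@retract_continuous phi)))).
- move=> x; apply: (@continuous_comp _ _ _ (fun x : 'rV[F]_m => x 0 i)).
    exact: coord_continuous.
  exact: height_continuous.
- exact: width_gt0.
- move=> x [s sK xs] fx; have [] := mirror_half (fphi s) (coordP _ _ xs) fx.
  by move=> ? ?; split; [exact: onA xs _|rewrite [f _]fon].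
- move=> x [s sK xs] fx; apply: onid.
  exact: mirror_id (fphi s) _ (coordP _ _ xs) fx.
- move=> x [s sK xs]; have [] := fold_half (fphi s) (coordP _ _ xs).
  by move=> ? ?; split; [exact: onA xs _|rewrite [f _]fon].
- move=> x [s sK xs] fx.
  have := fold_mirror (fphi s) (coordP _ _ xs) fx => E.
  apply/rowP => j; rewrite !mxE; case: eqP => // ->; exact: E.
- move=> x [s sK xs] fx; have [] := retract_zero (fphi s) (coordP _ _ xs) fx.
  by move=> ? ?; split; [exact: onA xs _|rewrite [f _]fon].
- move=> x [s sK xs] fx; apply: onid.
  exact: retract_id (fphi s) _ (coordP _ _ xs) fx.
Qed.

Inductive cuts (Q : set F * set F) : set F * set F -> Prop :=
| cuts_refl : cuts Q Q
| cuts_step Q' Q'' : cut Q Q' -> cuts Q' Q'' -> cuts Q Q''.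

Lemma with_pair_cuts P i Q Q' t : cuts Q Q' ->
  total_rank_ge R k (pair_product (with_pair P i Q')) t ->
  total_rank_ge R k (pair_product (with_pair P i Q)) t.
Proof. by elim=> // {}Q {}Q' Q'' QQ' _ IH /IH; exact: cut_total_rank. Qed.

Lemma cuts_total_rank P P' t : (forall i, cuts (P i) (P' i)) ->
  total_rank_ge R k (pair_product P') t -> total_rank_ge R k (pair_product P) t.
Proof.
move=> PP' H.
(* The stage at which exactly the coordinates in [l] are still uncut. *)
pose mix (l : seq 'I_m) i := if i \in l then P i else P' i.
suff : total_rank_ge R k (pair_product (mix (enum 'I_m))) t.
  congr (total_rank_ge _ _ (pair_product _) _); apply/funext => i.
  by rewrite /mix mem_enum.
elim: (enum 'I_m) => [|i l IH].
  by congr (total_rank_ge _ _ (pair_product _) _): H.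
have [il|il] := boolP (i \in l).
  move: IH; congr (total_rank_ge _ _ (pair_product _) _); apply/funext => j.
  by rewrite /mix inE; case: eqP => [->|//]; rewrite il.
have -> : mix (i :: l) = with_pair (mix l) i (P i).
  by apply/funext => j; rewrite /with_pair /mix inE; case: eqP => [->|].
apply: (with_pair_cuts (PP' i)).
suff -> : with_pair (mix l) i (P' i) = mix l by [].
apply/funext => j; rewrite /with_pair /mix; case: eqP => // ->.
by rewrite (negbTE il).
Qed.

End coordinate_cuts.

(** * Rank of a free action *)

(** Counting square roots of 1 serves tori and 2-groups alike: the source has the 2^r sign vectors,
    and their images have entries 1 or -1, determined by the places of -1 outside [s]. *)
Lemma free_action_rank (F : numFieldType) m r (s : {set 'I_m})
    (H X : set 'rV[F]_m) (phi : 'rV[F]_r -> 'rV[F]_m)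
    (psi : 'rV[F]_m -> 'rV[F]_r) :
    is_subgroup H -> group_isomorphism H phi psi -> acts_freely H X ->
    X (\row_i (if i \in s then 0 else 1)) ->
  (r <= #|~: s|)%N.
Proof.
move=> [HS _ _ _] [phiP _ phiM] free X0.
have coord1 n : sphere_power F n (const_mx 1).
  by move=> i; rewrite mxE /unit_sphere /= normr1.
have sphereM n (g h : 'rV[F]_n) : sphere_power F n g -> sphere_power F n h ->
    sphere_power F n (coord_mul g h).
  by move=> gS hS i; rewrite mxE /unit_sphere /= normrM gS hS mulr1.
have phi_inj t u :
    sphere_power F r t -> sphere_power F r u -> phi t = phi u -> t = u.
  by move=> /phiP[_ {2}<-] /phiP[_ {2}<-] ->.
have phi_neq0 t i : sphere_power F r t -> phi t 0 i != 0.
  move=> /phiP[/HS/(_ i) + _]; rewrite /unit_sphere /= -normr_eq0 => ->.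
  by rewrite oner_eq0.
have phi1 : phi (const_mx 1) = const_mx 1.
  apply/rowP => i; apply: (mulfI (phi_neq0 _ i (coord1 r))).
  have := phiM _ _ (coord1 r) (coord1 r).
  have -> : coord_mul (const_mx 1) (const_mx 1) = const_mx 1 :> 'rV[F]_r.
    by apply/rowP => j; rewrite !mxE mulr1.
  by move=> /rowP/(_ i); rewrite !mxE mulr1 => <-.
pose sgn (E : {set 'I_r}) : 'rV[F]_r := \row_i (if i \in E then -1 else 1).
have sgnS E : sphere_power F r (sgn E).
  by move=> i; rewrite mxE /unit_sphere /=; case: ifP; rewrite ?normrN normr1.
have sgnK E : coord_mul (sgn E) (sgn E) = const_mx 1.
  by apply/rowP => i; rewrite !mxE; case: ifP; rewrite ?mulrNN mulr1.
have phi_sgn E i : phi (sgn E) 0 i = 1 \/ phi (sgn E) 0 i = -1.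
  have := phiM _ _ (sgnS E) (sgnS E); rewrite sgnK phi1 => /rowP/(_ i).
  rewrite !mxE => /esym/eqP; rewrite -expr2 sqrf_eq1.
  by case/orP => /eqP->; [left|right].
pose J (E : {set 'I_r}) := [set i in ~: s | phi (sgn E) 0 i == -1].
have Jinj : injective J.
  move=> E E' /setP JE.
  suff : coord_mul (sgn E) (sgn E') = const_mx 1.
    move=> /rowP EE'; apply/setP => i; have := EE' i; rewrite !mxE.
    have N1 : (-1 : F) <> 1.
      by apply/eqP; rewrite lt_eqF// (@lt_trans _ _ 0)// oppr_lt0.
    by case: ifP; case: ifP => //; rewrite ?mulr1 ?mul1r.
  (* If [J E = J E'], the image of the product has entries 1 outside [s], hence fixes the given
     point; freeness makes it trivial. *)
  have S2 := sphereM _ _ _ (sgnS E) (sgnS E').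
  apply: phi_inj => //; rewrite phi1.
  have [/free fx _] := phiP _ S2; apply: fx X0 _.
  apply/rowP => i; rewrite phiM// !mxE; case: ifP => [_|is_]; first by rewrite mulr0.
  have := JE i; rewrite !inE is_ /= mulr1.
  have N1 : (1 : F) == -1 = false.
    by rewrite gt_eqF// (@lt_trans _ _ 0)// oppr_lt0.
  by case: (phi_sgn E i) => ->; case: (phi_sgn E' i) => ->;
    rewrite ?eqxx ?N1 ?mulrNN ?mulr1.
have : (#|[set J E | E : {set 'I_r}]| <= #|powerset (~: s)|)%N.
  apply: subset_leq_card; apply/fintype.subsetP => _ /imsetP[E _ ->]; rewrite powersetE.
  by apply/fintype.subsetP => i; rewrite !inE => /andP[].
rewrite (card_imset _ Jinj) card_powerset -cardsT -powersetT card_powerset.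
rewrite cardsT card_ord.
by rewrite leq_exp2l.
Qed.

(** * The final finite set *)

Section simplex_connected.
Variable R : realType.

(** Clamping the parameter makes the segment from [x] to [y] a continuous map on the whole line,
    with values in the simplex. *)
Definition unit_clamp (t : R) : R := Num.min (Num.max t 0) 1.

Lemma unit_clamp_continuous : continuous unit_clamp.
Proof.
move=> t; apply: (@continuous_min _ _ (fun t : R => Num.max t 0) (cst 1)).
  by apply: (@continuous_max _ _ id (cst 0)); [exact: cvg_id|exact: cvg_cst].
exact: cvg_cst.
Qed.

Lemma unit_clamp_bound t : 0 <= unit_clamp t <= 1.
Proof. by rewrite le_min ge_min le_max !lexx ler01 !orbT. Qed.

Variables (n : nat) (x y : std_simplex R n).

Lemma segment_simplex t :
  (1 - unit_clamp t) *: val x + unit_clamp t *: val y \in std_simplex R n.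
Proof.
have /andP[t0 t1] := unit_clamp_bound t.
apply/mem_set; split=> [j|].
  by rewrite !mxE addr_ge0// mulr_ge0 ?subr_ge0//; exact: simplex_ge0.
under eq_bigr do rewrite !mxE.
by rewrite big_split /= -!mulr_sumr !simplex_sum1 !mulr1 subrK.
Qed.

Definition segment_path t : std_simplex R n := SigSub (segment_simplex t).

Lemma segment_path_continuous : continuous segment_path.
Proof.
apply: continuous_comp_initial; apply: row_continuous => j.
have -> : (fun t => (set_val \o segment_path) t 0 j) =
    (fun t => (1 - unit_clamp t) * val x 0 j + unit_clamp t * val y 0 j).
  by apply/funext => t; rewrite /= !mxE.
move=> t; apply: cvgD; apply: cvgMr_tmp; last exact: unit_clamp_continuous.
by apply: cvgB; [exact: cvg_cst|exact: unit_clamp_continuous].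
Qed.

Lemma simplex_pm1_const (g : std_simplex R n -> R) : continuous g ->
  (forall z, g z = 1 \/ g z = -1) -> g x = g y.
Proof.
move=> gc g1.
have p0 : segment_path 0 = x.
  apply: simplex_inj => j; rewrite /= !mxE /unit_clamp maxxx min_l//.
  by rewrite subr0 mul1r mul0r addr0.
have p1 : segment_path 1 = y.
  apply: simplex_inj => j; rewrite /= !mxE /unit_clamp max_l// minxx.
  by rewrite subrr mul0r mul1r add0r.
have pc : {within `[0, 1], continuous (g \o segment_path)}.
  apply: continuous_subspaceT => t; apply: continuous_comp; last exact: gc.
  exact: segment_path_continuous.
have nz t : g (segment_path t) <> 0 by case: (g1 (segment_path t)) => ->; lra.
have ivt : ~ (Num.min (g x) (g y) <= (0 : R) <= Num.max (g x) (g y)).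
  by rewrite -p0 -p1 => /(IVT (@ler01 R) pc)[t _ /nz].
case: (g1 x) => gx; case: (g1 y) => gy; rewrite ?gx ?gy//; case: ivt;
  by rewrite gx gy; apply/andP; split;
    rewrite ?ge_min ?le_max ?oppr_le0 ler01 ?orbT.
Qed.

End simplex_connected.

Section sign_vectors.
Variables (R : realType) (k : fieldType) (F : numFieldType) (m : nat).
Variables (K : {set {set 'I_m}}) (s : {set 'I_m}).
Hypothesis sK : s \in K.
Hypothesis s_max : forall t : {set 'I_m}, t \in K -> s \subset t -> t = s.
Variables (P : 'I_m -> set F * set F) (u : F) (h : F -> R).
Hypothesis h_continuous : continuous h.
Hypotheses (hu : h u = 1) (hNu : h (- u) = -1).
Hypothesis P_in : forall i, i \in s ->
  (P i).1 `<=` [set 0] /\ (P i).2 = set0 /\ (P i).1 0.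
Hypothesis P_out : forall i, i \notin s ->
  forall z, (P i).2 z <-> z = u \/ z = - u.

(** For [i] in [s] the second set is empty, so a simplex that contributes a point contains [s], and
    by maximality it is [s]. *)
Lemma pair_product_signs x : pair_product K P x <->
  forall i, if i \in s then x 0 i = 0 else x 0 i = u \/ x 0 i = - u.
Proof.
split=> [[t tK xt] i|xP]; last first.
  exists s => // i; have := xP i; case: ifPn => is_.
    by move=> ->; have [_ []] := P_in is_.
  by move=> ?; apply/(P_out is_).
have ts : t = s.
  apply: s_max => //; apply/fintype.subsetP => j js; have := xt j.
  by case: ifP => // _; have [_ [-> _]] := P_in js.
have := xt i; rewrite ts; case: ifPn => is_.
  by have [+ _] := P_in is_; apply.
by move=> /(P_out is_).
Qed.

Lemma sign_vectors_total_rank :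
  total_rank_ge R k (pair_product K P) (2 ^ #|~: s|).
Proof.
pose pt (E : {set 'I_m}) : 'rV[F]_m :=
  \row_i (if i \in s then 0 else if i \in E then u else - u).
have ptA E : pair_product K P (pt E).
  apply/pair_product_signs => i; rewrite mxE; case: (i \in s) => //.
  by case: ifP; [left|right].
have uN : u <> - u by move=> uE; move: hNu; rewrite -uE hu; lra.
have pt_inj (E E' : {set 'I_m}) :
    E \subset ~: s -> E' \subset ~: s -> pt E = pt E' -> E = E'.
  move=> Es E's /rowP EE'; apply/setP => i.
  have [is_|nis] := boolP (i \in s).
    have sC (D : {set 'I_m}) : D \subset ~: s -> i \in D = false.
      by move=> /fintype.subsetP Ds; apply/negP => /Ds; rewrite inE is_.
    by rewrite !sC.
  have := EE' i; rewrite !mxE (negbTE nis).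
  by case: ifP; case: ifP => // _ _ /esym.
(* A 0-simplex is the point at its only vertex, so [c E] is the indicator of [pt E]. It is a cocycle
   because each coordinate is constant along a 1-simplex: outside [s], [h] makes it a continuous
   function with values 1 and -1. *)
pose c E : cochain R k 'rV[F]_m 0 :=
  fun t => if t (vertex R ord0) == pt E then 1 else 0.
exists (fun n => if n is 0 then 2 ^ #|~: s| else 0)%N, 1; split; last first.
  by rewrite big_ord_recl big_ord0 addn0.
case=> [|n]; last exact: cohomology_rank_ge0.
rewrite -card_powerset.
exists (fun j : 'I_#|powerset (~: s)| => c (enum_val j)); split.
  move=> j t tA; rewrite /coboundary !big_ord_recl big_ord0 addr0 expr0 mul1r /=.
  rewrite expr1 mulN1r /c /=.
  suff -> : t (face ord0 (vertex R ord0)) =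
      t (face (lift ord0 ord0) (vertex R ord0)).
    by rewrite subrr.
  apply/rowP => i; set a := face _ _; set b := face _ _.
  have tP y := (pair_product_signs (t y)).1 (tA y) i.
  have [is_|nis] := boolP (i \in s).
    by have := tP a; have := tP b; rewrite is_ => -> ->.
  have gc : continuous (fun y => h (t y 0 i)).
    move=> y; apply: (@continuous_comp _ _ _ (fun y => t y 0 i) h);
      last exact: h_continuous.
    apply: (@continuous_comp _ _ _ t (fun x : 'rV[F]_m => x 0 i)).
      exact: cts_fun.
    exact: coord_continuous.
  have g1 y : h (t y 0 i) = 1 \/ h (t y 0 i) = -1.
    by have := tP y; rewrite (negbTE nis) => -[->|->]; [left|right].
  have := simplex_pm1_const a b gc g1.
  have := tP a; have := tP b; rewrite (negbTE nis).
  have N1 : (1 : R) <> -1 by lra.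
  by move=> [->|->] [->|->] //; rewrite hu hNu => E; exfalso; apply: N1; lra.
move=> a aB j.
pose t0 : singular_simplex R 'rV[F]_m 0 := cst (pt (enum_val j)).
have t0A : simplex_in (pair_product K P) t0 by move=> y; exact: ptA.
have := aB _ t0A; rewrite fct_sumE (bigD1 j)//= big1 ?addr0.
  by rewrite -[X in X = _ -> _]/(_ * _) /c /= eqxx mulr1.
move=> i ij; rewrite -[LHS]/(_ * _) /c /=; case: eqP; last by rewrite mulr0.
have sub (l : 'I_#|powerset (~: s)|) : (enum_val l : {set 'I_m}) \subset ~: s.
  by rewrite -powersetE; exact: (enum_valP l).
by move=> /(pt_inj _ _ (sub _) (sub _))/enum_val_inj ji; rewrite ji eqxx in ij.
Qed.

End sign_vectors.

(** * Foldings of the interval and of the disk *)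

Section real_folding.
Variable R : realType.

Lemma real_id_continuous : continuous (id : R -> R).
Proof. by move=> x; exact: cvg_id. Qed.

Lemma real_opp_continuous : continuous (-%R : R -> R).
Proof. by move=> x; apply: cvgN; exact: cvg_id. Qed.

Lemma real_norm_continuous : continuous (Num.norm : R -> R).
Proof. by move=> x; apply: cvg_norm; exact: cvg_id. Qed.

(** With width 1 the band [|z| < 1] misses both ends, so the retraction only has to work on the
    interval, where a constant does. *)
Definition real_folding : folding R R :=
  @Folding R R id -%R Num.norm (cst 0) 1 real_id_continuous real_opp_continuous
    real_norm_continuous (@cst_continuous R R 0) ltr01.

Lemma real_folding_interval : folds real_folding (unit_disk R).
Proof.
rewrite /unit_disk; split=> z /= z1.
- by move=> z0; rewrite normrN oppr_le0.
- by move=> ->; rewrite oppr0.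
- by rewrite normr_id.
- by move=> z0; rewrite normrN ger0_norm.
- by rewrite normr0 ler01.
- by [].
Qed.

Lemma real_folding_ends : folds real_folding (unit_sphere R).
Proof.
rewrite /unit_sphere; split=> z /= z1.
- by move=> z0; rewrite normrN oppr_le0.
- by move=> ->; rewrite oppr0.
- by rewrite normr_id.
- by move=> z0; rewrite normrN ger0_norm.
- by rewrite z1 ltxx.
- by [].
Qed.

Lemma unit_sphere_real (z : R) : unit_sphere R z <-> z = 1 \/ z = - 1.
Proof.
rewrite /unit_sphere /=; split=> [|[]->]; rewrite ?normrN ?normr1//.
by move=> /eqP; rewrite eqr_norml ler01 andbT => /orP[] /eqP; [left|right].
Qed.

End real_folding.

Section complex_folding.
Variable R : realType.
Local Notation C := (complexes R).
Local Notation Re := (@complex.Re R).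
Local Notation Im := (@complex.Im R).

Lemma complex_normE (z : C) : `|z| = (Num.sqrt (Re z ^+ 2 + Im z ^+ 2))%:C%C.
Proof. exact: normc_def. Qed.

Lemma unit_disk_complex (z : C) : unit_disk C z <-> Re z ^+ 2 + Im z ^+ 2 <= 1.
Proof.
rewrite /unit_disk /= complex_normE lecE /= eqxx /= -[X in _ <= X]sqrtr1.
by rewrite ler_sqrt// ltr01.
Qed.

Lemma unit_sphere_complex (z : C) : unit_sphere C z <-> Re z ^+ 2 + Im z ^+ 2 = 1.
Proof.
have N0 : 0 <= Re z ^+ 2 + Im z ^+ 2 by rewrite addr_ge0// sqr_ge0.
rewrite /unit_sphere /= complex_normE; split=> [[] N1|->]; last by rewrite sqrtr1.
by rewrite -(sqr_sqrtr N0) N1 expr1n.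
Qed.

Lemma complex_coord_le (z : C) (r : R) :
  `|z| < r%:C%C -> `|Re z| < r /\ `|Im z| < r.
Proof.
rewrite complex_normE ltcE /= eqxx /= => zr.
split; apply: le_lt_trans zr; rewrite -sqrtr_sqr ler_wsqrtr//.
  by rewrite lerDl sqr_ge0.
by rewrite lerDr sqr_ge0.
Qed.

Lemma Re_continuous : continuous (Re : C -> R).
Proof.
move=> z U /nbhs_ballP[e /= e0 eU]; apply/nbhs_ballP.
exists (e%:C%C : C); first by rewrite /= ltcE /= eqxx.
by move=> w /complex_coord_le[zw _]; apply: eU; case: z w zw => [? ?] [? ?].
Qed.

Lemma Im_continuous : continuous (Im : C -> R).
Proof.
move=> z U /nbhs_ballP[e /= e0 eU]; apply/nbhs_ballP.
exists (e%:C%C : C); first by rewrite /= ltcE /= eqxx.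
by move=> w /complex_coord_le[_ zw]; apply: eU; case: z w zw => [? ?] [? ?].
Qed.

Lemma Complex_continuous (T : topologicalType) (a b : T -> R) :
  continuous a -> continuous b -> continuous (fun x => Complex (a x) (b x) : C).
Proof.
move=> ac bc x; apply/cvgrPdist_lt => -[e e'].
rewrite ltcE /= => /andP[/eqP -> e0].
have e20 : 0 < e / 2 by rewrite divr_gt0.
have FF : Filter (nbhs x) := nbhs_filter x.
have /cvgrPdist_lt/(_ _ e20) A := ac x.
have /cvgrPdist_lt/(_ _ e20) B := bc x.
near=> y.
rewrite complex_normE ltcE /= eqxx /=.
have Ay : `|a x - a y| < e / 2 by near: y; exact: A.
have By : `|b x - b y| < e / 2 by near: y; exact: B.
rewrite -(ger0_norm (ltW e0)) -sqrtr_sqr ltr_sqrt ?exprn_gt0//.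
rewrite -[X in X + _]real_normK ?num_real// -[X in _ + X]real_normK ?num_real//.
have := normr_ge0 (a x - a y); have := normr_ge0 (b x - b y).
by nra.
Unshelve. all: by end_near. Qed.

Lemma oppr_continuous (T : topologicalType) (a : T -> R) :
  continuous a -> continuous (fun x => - a x).
Proof. by move=> ac x; apply: cvgN; exact: ac. Qed.

Lemma normr_continuous (T : topologicalType) (a : T -> R) :
  continuous a -> continuous (fun x => `|a x|).
Proof. by move=> ac x; apply: cvg_norm; exact: ac. Qed.

Definition unit_clip (t : R) : R := Num.max (- 1) (Num.min 1 t).

Lemma unit_clip_continuous : continuous unit_clip.
Proof.
move=> t; apply: (@continuous_max _ _ (cst (- 1)) (fun t : R => Num.min 1 t)).
  exact: cvg_cst.
by apply: (@continuous_min _ _ (cst 1) id); [exact: cvg_cst|exact: cvg_id].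
Qed.

Lemma unit_clip_sqr_le1 t : unit_clip t ^+ 2 <= 1.
Proof.
have [c1 c2] : - 1 <= unit_clip t /\ unit_clip t <= 1.
  rewrite /unit_clip le_max lexx ge_max ge_min lexx andbT; split => //; lra.
nra.
Qed.

Lemma unit_clip_id t : t ^+ 2 <= 1 -> unit_clip t = t.
Proof.
move=> t1; have [tN t2] : - 1 <= t /\ t <= 1 by split; nra.
by rewrite /unit_clip min_r// max_r.
Qed.

Lemma unit_clip_sqr1 t : 1 <= t ^+ 2 -> unit_clip t ^+ 2 = 1.
Proof.
move=> t1; have [t0|t0] := lerP 0 t.
  have t2 : 1 <= t by nra.
  by rewrite /unit_clip min_l// max_r ?expr1n// lerNl; lra.
have t2 : t <= -1 by nra.
rewrite /unit_clip min_r ?max_l ?sqrrN ?expr1n//; lra.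
Qed.

(* Near the imaginary axis [y (1 + |x|)] has absolute value at least 1 on the
   unit circle and it equals [y] on the axis, so clipping it retracts onto the
   axis and preserves both the disk and the circle. *)
Definition Re_retract (z : C) : C :=
  Complex 0 (unit_clip (Im z * (1 + `|Re z|))).

Lemma Re_retract_continuous : continuous Re_retract.
Proof.
apply: Complex_continuous; first exact: cst_continuous.
move=> z.
apply: (@continuous_comp _ _ _ (fun z : C => Im z * (1 + `|Re z|)) unit_clip).
  have mulc (T : topologicalType) (a b : T -> R) :
      continuous a -> continuous b -> continuous (fun x => a x * (1 + `|b x|)).
    move=> ac bc x; apply: cvgM; first exact: ac.
    by apply: cvgD; [exact: cvg_cst|exact: normr_continuous].
  exact: mulc Im_continuous Re_continuous z.
exact: unit_clip_continuous.
Qed.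

Lemma Re_mirror_continuous : continuous (fun z : C => Complex (- Re z) (Im z) : C).
Proof.
apply: Complex_continuous; last exact: Im_continuous.
by apply: oppr_continuous; exact: Re_continuous.
Qed.

Lemma Re_fold_continuous : continuous (fun z : C => Complex `|Re z| (Im z) : C).
Proof.
apply: Complex_continuous; last exact: Im_continuous.
by apply: normr_continuous; exact: Re_continuous.
Qed.

Lemma half_gt0 : 0 < 2^-1 :> R. Proof. by rewrite invr_gt0. Qed.

Definition Re_folding : folding R C :=
  @Folding R C Re (fun z => Complex (- Re z) (Im z))
    (fun z => Complex `|Re z| (Im z))
    Re_retract 2^-1 Re_continuous Re_mirror_continuous Re_fold_continuous
    Re_retract_continuous half_gt0.

Lemma Re_folding_disk : folds Re_folding (unit_disk C).
Proof.
split=> -[a b] /unit_disk_complex /= ab.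
- move=> a0; split; last by rewrite oppr_le0.
  by apply/unit_disk_complex; rewrite /= sqrrN.
- by move=> ->; rewrite oppr0.
- split; last exact: normr_ge0.
  by apply/unit_disk_complex; rewrite /= real_normK ?num_real.
- by move=> a0; rewrite normrN ger0_norm.
- move=> _; split => //.
  by apply/unit_disk_complex; rewrite /= expr0n add0r unit_clip_sqr_le1.
- move=> a0; rewrite /Re_retract /= a0 normr0 addr0 mulr1 unit_clip_id//.
  by apply: le_trans ab; rewrite lerDr sqr_ge0.
Qed.

Lemma Re_folding_circle : folds Re_folding (unit_sphere C).
Proof.
split=> -[a b] /unit_sphere_complex /= ab.
- move=> a0; split; last by rewrite oppr_le0.
  by apply/unit_sphere_complex; rewrite /= sqrrN.
- by move=> ->; rewrite oppr0.
- split; last exact: normr_ge0.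
  by apply/unit_sphere_complex; rewrite /= real_normK ?num_real.
- by move=> a0; rewrite normrN ger0_norm.
- move=> a2; split => //.
  apply/unit_sphere_complex; rewrite /= expr0n add0r unit_clip_sqr1//.
  rewrite exprMn; have -> : b ^+ 2 = 1 - `|a| ^+ 2.
    by rewrite real_normK ?num_real//; lra.
  have := normr_ge0 a; set t := `|a| in a2 *; move=> t0.
  (* Here t = |Re z|; the width 1/2 keeps the last factor positive, so clipping lands on the
     circle. *)
  have -> : (1 - t ^+ 2) * (1 + t) ^+ 2 = 1 + t * (2 - 2 * t ^+ 2 - t ^+ 3) by ring.
  rewrite lerDl mulr_ge0//.
  have t2 : t ^+ 2 <= 4^-1 by nra.
  have t3 : t ^+ 3 <= t ^+ 2 by rewrite exprS; nra.
  lra.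
- move=> a0; rewrite /Re_retract /= a0 normr0 addr0 mulr1 unit_clip_id//.
  by rewrite -ab lerDr sqr_ge0.
Qed.

Lemma Im_mirror_continuous : continuous (fun z : C => Complex (Re z) (- Im z) : C).
Proof.
apply: Complex_continuous; first exact: Re_continuous.
by apply: oppr_continuous; exact: Im_continuous.
Qed.

Lemma Im_fold_continuous : continuous (fun z : C => Complex (Re z) `|Im z| : C).
Proof.
apply: Complex_continuous; first exact: Re_continuous.
by apply: normr_continuous; exact: Im_continuous.
Qed.

Lemma Im_retract_continuous : continuous (fun z : C => Complex (Re z) 0 : C).
Proof. by apply: Complex_continuous; [exact: Re_continuous|exact: cst_continuous]. Qed.

Definition Im_folding : folding R C :=
  @Folding R C Im (fun z => Complex (Re z) (- Im z))
    (fun z => Complex (Re z) `|Im z|)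
    (fun z => Complex (Re z) 0) 2^-1 Im_continuous Im_mirror_continuous
    Im_fold_continuous Im_retract_continuous half_gt0.

Lemma Im_folding_disk : folds Im_folding (unit_disk C `&` [set z | Re z = 0]).
Proof.
split=> -[a b] [/unit_disk_complex /= ab a0].
- move=> b0; split; last by rewrite oppr_le0.
  by split=> //; apply/unit_disk_complex; rewrite /= sqrrN.
- by move=> ->; rewrite oppr0.
- split; last exact: normr_ge0.
  by split=> //; apply/unit_disk_complex; rewrite /= real_normK ?num_real.
- by move=> b0; rewrite normrN ger0_norm.
- move=> _; split=> //; split=> //; apply/unit_disk_complex => /=.
  by rewrite a0 expr0n addr0 ler01.
- by move=> ->.
Qed.

Lemma Im_folding_circle : folds Im_folding (unit_sphere C `&` [set z | Re z = 0]).
Proof.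
split=> -[a b] [/unit_sphere_complex /= ab a0].
- move=> b0; split; last by rewrite oppr_le0.
  by split=> //; apply/unit_sphere_complex; rewrite /= sqrrN.
- by move=> ->; rewrite oppr0.
- split; last exact: normr_ge0.
  by split=> //; apply/unit_sphere_complex; rewrite /= real_normK ?num_real.
- by move=> b0; rewrite normrN ger0_norm.
(* With Re z = 0 the circle has only points with |Im z| = 1, outside the band of width 1/2. *)
- rewrite ltr_norml => /andP[b1 b2]; exfalso.
  by move: ab; rewrite a0; nra.
- by move=> ->.
Qed.

End complex_folding.

(** * Application to the moment-angle complexes *)

Lemma polyhedral_productE (F : numFieldType) m (K : {set {set 'I_m}})
    (D S : set F) :
  polyhedral_product K D S = pair_product K (fun=> (D, S)).
Proof. by apply/seteqP; split=> x [s sK xs]; exists s. Qed.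

Lemma maximal_simplex m (K : {set {set 'I_m}}) : simplicial_complex K ->
  exists2 s : {set 'I_m}, s \in K &
    forall t : {set 'I_m}, t \in K -> s \subset t -> t = s.
Proof.
move=> [K0 _ _]; have [s /maxsetP[sK smax] _] := @maxset_exists _ (mem K) _ K0.
by exists s => // t tK st; exact: smax.
Qed.

Lemma polyhedral_product_indicator (F : numFieldType) m (K : {set {set 'I_m}})
    (s : {set 'I_m}) : s \in K ->
  polyhedral_product K (unit_disk F) (unit_sphere F)
    (\row_i (if i \in s then 0 else 1)).
Proof.
move=> sK; exists s => //= i; rewrite mxE /unit_disk /unit_sphere.
by case: (i \in s); rewrite /= ?normr0 ?ler01 ?normr1.
Qed.

Lemma real_moment_angle_total_rank (R : realType) (k : fieldType) m
    (K : {set {set 'I_m}}) (s : {set 'I_m}) :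
    s \in K -> (forall t : {set 'I_m}, t \in K -> s \subset t -> t = s) ->
  total_rank_ge R k (real_moment_angle_complex R K) (2 ^ #|~: s|).
Proof.
move=> sK smax; rewrite /real_moment_angle_complex polyhedral_productE.
pose Q : set R * set R := (unit_disk R, unit_sphere R).
pose Q0 : set R * set R := (Q.1 `&` [set z | z = 0], Q.2 `&` [set z | z = 0]).
apply: (@cuts_total_rank R k R m K _ (fun i => if i \in s then Q0 else Q)) => [i|].
  case: (i \in s); last exact: cuts_refl.
  apply: cuts_step (cuts_refl _ _); exists (real_folding R); split=> //.
    exact: real_folding_interval.
  exact: real_folding_ends.
apply: (@sign_vectors_total_rank R k R m K s sK smax _ 1 id) => //.
- exact: real_id_continuous.
- move=> i ->; split; first by move=> z [].
  split; last by split=> //; rewrite /Q /unit_disk /= normr0 ler01.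
  apply/seteqP; split=> // z [/= zS z0]; move: zS.
  by rewrite z0 /unit_sphere /= normr0 => /esym/eqP; rewrite oner_eq0.
- by move=> i /negbTE-> z; exact: unit_sphere_real.
Qed.

Lemma moment_angle_total_rank (R : realType) (k : fieldType) m
    (K : {set {set 'I_m}}) (s : {set 'I_m}) :
    s \in K -> (forall t : {set 'I_m}, t \in K -> s \subset t -> t = s) ->
  total_rank_ge R k (moment_angle_complex R K) (2 ^ #|~: s|).
Proof.
move=> sK smax; rewrite /moment_angle_complex polyhedral_productE.
pose C := complexes R.
pose Q : set C * set C := (unit_disk C, unit_sphere C).
pose Q1 : set C * set C := (Q.1 `&` [set z | complex.Re z = 0],
  Q.2 `&` [set z | complex.Re z = 0]).
pose Q0 : set C * set C := (Q1.1 `&` [set z | complex.Im z = 0],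
  Q1.2 `&` [set z | complex.Im z = 0]).
have Q_Q1 : cut R Q Q1.
  exists (Re_folding R); split=> //; first exact: Re_folding_disk.
  exact: Re_folding_circle.
have Q1_Q0 : cut R Q1 Q0.
  exists (Im_folding R); split=> //; first exact: Im_folding_disk.
  exact: Im_folding_circle.
(* Outside [s] the circle is reduced to its two imaginary points, told apart by Im; inside [s] the
   disk shrinks to 0 and the circle to the empty set. *)
apply: (@cuts_total_rank R k C m K _ (fun i => if i \in s then Q0 else Q1)) => [i|].
  apply: cuts_step Q_Q1 _; case: (i \in s); last exact: cuts_refl.
  exact: cuts_step Q1_Q0 (cuts_refl _ _).
apply: (@sign_vectors_total_rank R k C m K s sK smax _ (Complex 0 1)
  (@complex.Im R)) => //.
- exact: Im_continuous.
- move=> i ->; split.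
    by move=> [a b] [[_ /= ->] /= ->].
  split; last first.
    split => //; split => //; apply/unit_disk_complex.
    by rewrite /= expr0n addr0 ler01.
  apply/seteqP; split=> // z [[/unit_sphere_complex + /= z0] /= z1].
  by rewrite z0 z1 expr0n addr0 => /esym/eqP; rewrite oner_eq0.
- move=> i /negbTE-> [a b]; split=> [[/unit_sphere_complex /= ab a0]|].
    move: ab; rewrite a0 expr0n add0r => /eqP; rewrite sqrf_eq1.
    by case/orP => /eqP->; [left|right; rewrite -[RHS]/(Complex _ _) oppr0].
  by move=> [[-> ->]|[-> ->]]; split; rewrite /= ?oppr0//;
    apply/unit_sphere_complex; rewrite /= ?oppr0 ?sqrrN expr0n expr1n add0r.
Qed.

Unset Implicit Arguments.

Theorem corollary1p4 (R : realType) (m : nat) (m_gt0 : (0 < m)%N)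
    (K : {set {set 'I_m}}) (hK : simplicial_complex K) :
  (forall (r : nat) (H : set 'rV[complexes R]_m) (k0 : fieldType),
     [pchar k0] =i pred0 ->
     is_subtorus r H ->
     acts_freely H (moment_angle_complex R K) ->
     ((2 ^ r)%:R%:E <=
        total_cohomology_dim R k0 (moment_angle_complex R K))%E) /\
  (forall (r : nat) (H : set 'rV[R]_m) (k2 : fieldType),
     2%N \in [pchar k2] ->
     is_two_subgroup r H ->
     acts_freely H (real_moment_angle_complex R K) ->
     ((2 ^ r)%:R%:E <=
        total_cohomology_dim R k2 (real_moment_angle_complex R K))%E).
Proof.
have [s sK smax] := maximal_simplex hK.
have total_rank_leq (k : fieldType) (X : topologicalType) (A : set X) r :
    (r <= #|~: s|)%N -> total_rank_ge R k A (2 ^ #|~: s|) ->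
    ((2 ^ r)%:R%:E <= total_cohomology_dim R k A)%E.
  move=> rs AP; apply: total_cohomology_dim_ge.
  have [N [M [NP sN]]] := AP; exists N, M; split=> //.
  by apply: leq_trans sN; rewrite leq_exp2l.
split=> r H k _.
  move=> [Hsub _ [phi [psi [iso _ _]]]] free; apply: total_rank_leq.
    exact: free_action_rank Hsub iso free
      (polyhedral_product_indicator (complexes R) sK).
  exact: moment_angle_total_rank.
move=> [Hsub [phi [psi iso]]] free; apply: total_rank_leq.
  exact: free_action_rank Hsub iso free (polyhedral_product_indicator R sK).
exact: real_moment_angle_total_rank.
Qed.
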